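(* Let $\sigma>0$ and $P\in\mathbb{R}^n$. Suppose $\overline{H}$ is strictly convex in a neighborhood of the point $P$. For each $Q\in\mathbb{R}^n$ let $u(x,Q)$ be a periodic viscosity solution of $$-\frac{\sigma^2}{2}\Delta u+H(Q+D_xu,x)=\overline{H}(Q),$$ and let $\theta$ be the density associated with $P$. Then there is a constant $C>0$, not depending on $P'$, such that $$\int_{\mathbb{T}^n}\left|P+D_xu(x,P)-P'-D_xu(x,P')\right|^2\theta\,dx\ge C|P-P'|^2$$ for $|P-P'|$ sufficiently small.
   Context: Let $\mathbb{T}^n=\mathbb{R}^n/\mathbb{Z}^n$ and $\Omega=\mathbb{T}^n\times\mathbb{R}^n$, with points $(x,v)$. The Lagrangian $L(x,v)$ is smooth in both variables, $\mathbb{Z}^n$-periodic in $x$, coercive and strictly convex in $v$, and $L\ge0$; there is a function $\gamma=\gamma(|v|)\ge1$ with $L(x,v)/\gamma(v)\to+\infty$ and $|v|/\gamma(v)\to0$ as $|v|\to\infty$. Set $H(p,x)=\sup_v(-p\cdot v-L(x,v))$. For $Q\in\mathbb{R}^n$, $\overline{H}(Q)$ is the unique real number for which the equation displayed in the claim has a $\mathbb{Z}^n$-periodic viscosity solution $u(x,Q)$; this solution is $C^2$ in $x$ and unique up to an additive constant. The function $Q\mapsto\overline{H}(Q)$ is convex. The density $\theta$ associated with $P$ is the density of the projection onto the $x$ coordinates of a stochastic Mather measure for the Lagrangian $L(x,v)+P\cdot v$, i.e. of a probability measure $\mu$ on $\Omega$ that minimizes $\int_\Omega(L+P\cdot v)\,d\mu$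 among probability measures with $\int_\Omega\gamma\,d\mu<\infty$ and $\int_\Omega\left(\frac{\sigma^2}{2}\Delta\varphi+v\cdot D_x\varphi\right)d\mu=0$ for all $\varphi=\varphi(x)\in C^2(\mathbb{T}^n)$ (the constraint attached to the controlled diffusion $dx=v\,dt+\sigma\,dw$). It satisfies $\theta\in W^{1,2}(\mathbb{T}^n)$, $\theta\ge0$, $\int_{\mathbb{T}^n}\theta\,dx=1$, and is a weak solution on $\mathbb{T}^n$ of $-\nabla\cdot(\theta v(x))+\frac12\sigma^2\Delta\theta=0$ with $v(x)=-D_pH(P+D_xu(x,P),x)$. *)

(* Defs.v *)
From HB Require Import structures.
From mathcomp Require Import all_boot all_order all_algebra.
From mathcomp Require Import all_classical all_reals all_analysis.

Set Implicit Arguments.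
Unset Strict Implicit.
Unset Printing Implicit Defensive.

Import Order.TTheory GRing.Theory Num.Theory.
Import numFieldNormedType.Exports.

Local Open Scope classical_set_scope.
Local Open Scope ring_scope.

(* Functions on T^n = R^n / Z^n are represented by Z^n-periodic functions on
   R^n = 'rV[R]_n, and T^n as a measurable space by the fundamental domain
   [0, 1[^n. *)

Section euclidean.
Context {R : realType}.

(* The library norm on 'rV[R]_n is the sup norm; it gives the same topology,
   but the Euclidean norm is the one that occurs in the estimates. *)
Definition dotv n (v w : 'rV[R]_n) : R := \sum_(i < n) v 0 i * w 0 i.

Definition enorm n (v : 'rV[R]_n) : R := Num.sqrt (dotv v v).

Definition periodic n (T : Type) (f : 'rV[R]_n -> T) : Prop :=
  forall (x : 'rV[R]_n) (k : 'rV[int]_n), f (x + map_mx intr k) = f x.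

(* In finite dimension, continuity of all iterated directional derivatives
   up to order k is the usual C^k class. *)
Fixpoint Ck (V : normedModType R) (k : nat) (f : V -> R) : Prop :=
  if k is k'.+1 then
    continuous f /\
    forall v, (forall x, derivable f x v) /\ Ck k' (fun x => 'D_v f x)
  else continuous f.

Definition smooth (V : normedModType R) (f : V -> R) : Prop :=
  forall k, Ck k f.

Definition grad n (f : 'rV[R]_n -> R) (x : 'rV[R]_n) : 'rV[R]_n :=
  \row_(i < n) 'D_(delta_mx 0 i) f x.

Definition laplacian n (f : 'rV[R]_n -> R) (x : 'rV[R]_n) : R :=
  \sum_(i < n) 'D_(delta_mx 0 i) (fun y => 'D_(delta_mx 0 i) f y) x.

Definition strictly_convex_on (V : lmodType R) (A : set V) (f : V -> R) : Prop :=
  forall v w, A v -> A w -> v != w ->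
  forall t : R, 0 < t < 1 ->
    f (t *: v + (1 - t) *: w) < t * f v + (1 - t) * f w.

End euclidean.

Section borel_rV.
Context {d : measure_display} {T : sigmaRingType d} (n : nat).

Let coords : 'I_n -> 'rV[T]_n -> T := fun i x => x 0 i.

Let rV_set0 : g_sigma_preimage coords set0.
Proof. exact: sigma_algebra0. Qed.

Let rV_setC A : g_sigma_preimage coords A -> g_sigma_preimage coords (~` A).
Proof. exact: sigma_algebraC. Qed.

Let rV_bigcup (F : _^nat) : (forall i, g_sigma_preimage coords (F i)) ->
  g_sigma_preimage coords (\bigcup_i (F i)).
Proof. exact: sigma_algebra_bigcup. Qed.

(* The product sigma-algebra on 'rV[T]_n, generated by the coordinates; for
   T = R it is the Borel sigma-algebra. *)
HB.instance Definition _ := @isMeasurable.Build (measure_tuple_display d)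
  'rV[T]_n (g_sigma_preimage coords) rV_set0 rV_setC rV_bigcup.

End borel_rV.

Section torus_measure.
Context {R : realType}.

Definition cons_rV n (z : measurableTypeR R * 'rV[R]_n) : 'rV[R]_n.+1 :=
  row_mx (z.1 : R)%:M z.2 : 'rV_(1 + n).

Lemma measurable_cons_rV n : measurable_fun [set: measurableTypeR R * 'rV[R]_n] (@cons_rV n).
Proof.
have mcoord (i : 'I_n.+1) :
    measurable_fun [set: measurableTypeR R * 'rV[R]_n] (fun z => cons_rV z 0 i).
  have [i0 ii0|j ij] := @splitP 1 n i.
    have -> : (fun z : measurableTypeR R * 'rV[R]_n => cons_rV z 0 i) = fst.
      apply/funext => z; rewrite /cons_rV.
      have -> : i = @lshift 1 n i0 by apply: val_inj; rewrite /= ii0.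
      by apply: etrans (row_mxEl _ _ _ _) _; rewrite ord1 mxE eqxx mulr1n.
    exact: measurable_fst.
  have -> : (fun z : measurableTypeR R * 'rV[R]_n => cons_rV z 0 i) =
            (fun v : 'rV[R]_n => v 0 j) \o snd.
    apply/funext => z; rewrite /cons_rV.
    have -> : i = @rshift 1 n j by apply: val_inj; rewrite /= ij.
    exact: row_mxEr.
  apply: measurableT_comp => // _ Y mY; rewrite setTI.
  apply: sub_sigma_algebra => /=; rewrite -bigcup_seq/=.
  exists j => /=; first by rewrite mem_index_enum.
  by exists Y => //; rewrite setTI.
move=> _; apply: (@measurability _ _ _ _ _ _
  (\big[setU/set0]_(i < n.+1)
    preimage_set_system setT (fun x : 'rV[R]_n.+1 => x 0 i) measurable)) => //.
move=> _ [B + <-]; rewrite -bigcup_seq => -[i _ [C mC <-]].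
by rewrite !setTI; have := mcoord i measurableT C mC; rewrite setTI.
Qed.

HB.instance Definition _ n := isMeasurableFun.Build _ _ _ _
  (@cons_rV n) (@measurable_cons_rV n).

(* Lebesgue measure of T^n: the n-fold product of the Lebesgue measure on the
   unit interval. *)
Fixpoint torus_measure n : probability 'rV[R]_n R :=
  if n is n'.+1 then
    distribution (uniform_prob (@ltr01 R) \x torus_measure n')%E (@cons_rV n')
  else dirac (0 : 'rV[R]_0).

End torus_measure.

Section lagrangian.
Context {R : realType} (n : nat).
Implicit Types (L H : 'rV[R]_n -> 'rV[R]_n -> R) (gamma : R -> R).

(* Convergence to +oo as |v| -> +oo in T^n x R^n, hence uniformly in x. *)
Definition tends_to_pinfty (f : 'rV[R]_n -> 'rV[R]_n -> R) : Prop :=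
  forall M : R, exists r : R, forall x v, r <= enorm v -> M <= f x v.

Record is_lagrangian L : Prop := IsLagrangian {
  lagr_smooth : smooth (fun z : 'rV[R]_n * 'rV[R]_n => L z.1 z.2) ;
  lagr_periodic : periodic L ;
  lagr_coercive : tends_to_pinfty L ;
  lagr_strictly_convex : forall x, strictly_convex_on setT (L x) ;
  lagr_ge0 : forall x v, 0 <= L x v }.

(* Measurability is what gives a meaning to the integral of gamma. *)
Record is_growth_function L gamma : Prop := IsGrowthFunction {
  growth_measurable : measurable_fun setT gamma ;
  growth_ge1 : forall v : 'rV[R]_n, 1 <= gamma (enorm v) ;
  growth_lagr : tends_to_pinfty (fun x v => L x v / gamma (enorm v)) ;
  growth_linear : (fun r : R => r / gamma r) @ +oo --> 0 }.

Definition hamiltonian L (p x : 'rV[R]_n) : R :=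
  sup (range (fun v : 'rV[R]_n => - dotv p v - L x v)).

(* Viscosity solutions of - sigma^2 / 2 Delta w + H(Q + D_x w, x) = c. *)
Definition viscosity_subsolution H (sigma : R) (Q : 'rV[R]_n) (c : R)
    (w : 'rV[R]_n -> R) : Prop :=
  forall (phi : 'rV[R]_n -> R) (x0 : 'rV[R]_n), Ck 2 phi ->
    (\forall y \near x0, w y - phi y <= w x0 - phi x0) ->
    - (sigma ^+ 2 / 2) * laplacian phi x0 + H (Q + grad phi x0) x0 <= c.

Definition viscosity_supersolution H (sigma : R) (Q : 'rV[R]_n) (c : R)
    (w : 'rV[R]_n -> R) : Prop :=
  forall (phi : 'rV[R]_n -> R) (x0 : 'rV[R]_n), Ck 2 phi ->
    (\forall y \near x0, w x0 - phi x0 <= w y - phi y) ->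
    c <= - (sigma ^+ 2 / 2) * laplacian phi x0 + H (Q + grad phi x0) x0.

Record periodic_viscosity_solution H (sigma : R) (Q : 'rV[R]_n) (c : R)
    (w : 'rV[R]_n -> R) : Prop := PeriodicViscositySolution {
  visc_continuous : continuous w ;
  visc_periodic : periodic w ;
  visc_sub : viscosity_subsolution H sigma Q c w ;
  visc_super : viscosity_supersolution H sigma Q c w }.

(* c is the unique real number for which the cell problem at Q is solvable. *)
Definition is_effective_value H (sigma : R) (Q : 'rV[R]_n) (c : R) : Prop :=
  (exists w, periodic_viscosity_solution H sigma Q c w) /\
  (forall c', (exists w, periodic_viscosity_solution H sigma Q c' w) -> c' = c).

Record is_effective_hamiltonian H (sigma : R) (Hbar : 'rV[R]_n -> R) : Prop :=
  IsEffectiveHamiltonian {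
  eff_value : forall Q, is_effective_value H sigma Q (Hbar Q) ;
  eff_regular : forall Q w,
    periodic_viscosity_solution H sigma Q (Hbar Q) w -> Ck 2 w ;
  eff_unique : forall Q w w',
    periodic_viscosity_solution H sigma Q (Hbar Q) w ->
    periodic_viscosity_solution H sigma Q (Hbar Q) w' ->
    exists a, forall x, w x = w' x + a ;
  eff_convex : forall (Q Q' : 'rV[R]_n) (t : R), 0 <= t <= 1 ->
    Hbar (t *: Q + (1 - t) *: Q') <= t * Hbar Q + (1 - t) * Hbar Q' }.

End lagrangian.

Section mather_measures.
Context {R : realType} (n : nat).
Implicit Types (L : 'rV[R]_n -> 'rV[R]_n -> R) (gamma : R -> R).
Local Open Scope ereal_scope.


Definition phase_space : set ('rV[R]_n * 'rV[R]_n) :=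
  [set z : 'rV[R]_n * 'rV[R]_n | forall i, (0 <= z.1 0%R i < 1)%R].

Record admissible gamma (sigma : R)
    (mu : probability ('rV[R]_n * 'rV[R]_n)%type R) : Prop := Admissible {
  adm_support : mu phase_space = 1 ;
  adm_growth : \int[mu]_z (gamma (enorm z.2))%:E < +oo ;
  adm_constraint : forall phi : 'rV[R]_n -> R, periodic phi -> Ck 2 phi ->
    \int[mu]_z (sigma ^+ 2 / 2 * laplacian phi z.1
                + dotv z.2 (grad phi z.1))%:E = 0 }.

Definition action L (P : 'rV[R]_n)
    (mu : probability ('rV[R]_n * 'rV[R]_n)%type R) : \bar R :=
  \int[mu]_z (L z.1 z.2 + dotv P z.2)%:E.

Definition mather_measure L gamma (sigma : R) (P : 'rV[R]_n)
    (mu : probability ('rV[R]_n * 'rV[R]_n)%type R) : Prop :=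
  admissible gamma sigma mu /\
  forall nu, admissible gamma sigma nu -> action L P mu <= action L P nu.

(* g is the weak gradient of f, and f is in W^{1,2}(T^n). *)
Record sobolev12 (f : 'rV[R]_n -> R) (g : 'rV[R]_n -> 'rV[R]_n) : Prop :=
  Sobolev12 {
  sob_periodic : periodic f ;
  sob_measurable : measurable_fun setT f ;
  sob_L2 : (torus_measure n).-integrable setT (fun x => (f x ^+ 2)%:E) ;
  sob_grad_periodic : periodic g ;
  sob_grad_measurable : measurable_fun setT g ;
  sob_grad_L2 : (torus_measure n).-integrable setT
                  (fun x => (enorm (g x) ^+ 2)%:E) ;
  sob_weak : forall (phi : 'rV[R]_n -> R) (i : 'I_n),
    periodic phi -> smooth phi ->
    \int[torus_measure n]_x (f x * grad phi x 0%R i)%:E =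
    - \int[torus_measure n]_x (g x 0%R i * phi x)%:E }.

(* Weak solutions in W^{1,2}(T^n) of
   - div (theta b) + sigma^2 / 2 Delta theta = 0. *)
Definition weak_fokker_planck (sigma : R) (b : 'rV[R]_n -> 'rV[R]_n)
    (theta : 'rV[R]_n -> R) : Prop :=
  exists2 g, sobolev12 theta g &
  forall phi h, sobolev12 phi h ->
    \int[torus_measure n]_x (theta x * dotv (b x) (h x)
                             - sigma ^+ 2 / 2 * dotv (g x) (h x))%:E = 0.

Definition is_projected_density (theta : 'rV[R]_n -> R)
    (mu : probability ('rV[R]_n * 'rV[R]_n)%type R) : Prop :=
  forall A : set 'rV[R]_n, measurable A ->
    pushforward mu fst A = \int[torus_measure n]_(x in A) (theta x)%:E.

Record mather_density L gamma (sigma : R) (u : 'rV[R]_n -> 'rV[R]_n -> R)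
    (P : 'rV[R]_n) (theta : 'rV[R]_n -> R) : Prop := MatherDensity {
  dens_mather : exists2 mu, mather_measure L gamma sigma P mu
                          & is_projected_density theta mu ;
  dens_ge0 : {ae torus_measure n, forall x, (0 <= theta x)%R} ;
  dens_total : \int[torus_measure n]_x (theta x)%:E = 1 ;
  (* theta \in W^{1,2}(T^n) is part of weak_fokker_planck *)
  dens_weak : weak_fokker_planck sigma
    (fun x => - grad (fun p => hamiltonian L p x)%R (P + grad (u P) x))%R
    theta }.

End mather_measures.

(* Main.v *)
Require Import Defs.
From mathcomp Require Import all_boot all_order all_algebra.
From mathcomp Require Import all_classical all_reals all_analysis.
From mathcomp Require Import measurable_realfun lra ring.

Set Implicit Arguments.
Unset Strict Implicit.
Unset Printing Implicit Defensive.

Import Order.TTheory GRing.Theory Num.Theory.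
Import numFieldNormedType.Exports.

Local Open Scope classical_set_scope.
Local Open Scope ring_scope.

(* Testing the Fokker-Planck equation of theta, whose drift is bounded, shows
   that int theta (a Laplacian phi - B sum_i |d_i phi|) <= 0, a = sigma^2 / 2,
   for every smooth periodic phi. For phi a product of the kernels
   cos^(2 N_i) (pi (x_i - y_i)) this is a recursion in N which, compared with
   the Wallis recursion for the Lebesgue integral of phi, gives
   int theta phi >= c int phi with c > 0 independent of y and N. These products
   concentrate at y, so int F theta >= c int F for continuous periodic F >= 0.
   Take F = |q + D w|^2 with q = P - P' and w = u(., P) - u(., P'): since D w
   has mean zero, int F >= |q|^2. *)

(** * The torus measure and partial derivatives *)

Section torus_integral.
Context {R : realType}.

(** [theta] is known only through a weak equation with bounded drift, so its lower bound is read off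
    from integrals against explicit test functions instead of a pointwise argument such as Harnack's
    inequality. In one variable the second derivative of cos^(2 m) carries a factor m^2, the drift
    term only a factor m. With k = B / (a pi) and a weight w > 0, 2 k |sin| |cos| <= w sin^2 + (k^2
    / w) cos^2; this perturbs the Wallis ratio (2 m - 1) / (2 m) by relative errors of order w / m^2
    and 1 / (m w). The weight w = sqrt m balances them at m^(-3/2). That order is summable, so the
    product of the perturbed ratios stays comparable to the Wallis product, whence a constant
    uniform in N. In n variables the recursion couples the coordinates through a sum, yet products
    of one-variable solutions solve it exactly, so the constant is an n-th power. It depends on n,
    [sigma] and the drift at P only, hence not on P'. *)

Lemma measurable_coord n (i : 'I_n) :
  measurable_fun setT (fun x : 'rV[R]_n => x 0 i).
Proof.
move=> _ Y mY; rewrite setTI.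
apply: sub_sigma_algebra => /=; rewrite -bigcup_seq/=.
exists i => /=; first by rewrite mem_index_enum.
by exists Y => //; rewrite setTI.
Qed.

(** The sigma-algebra is generated by the coordinates, so measurability comes from a limit: [f] is
    evaluated at the grid point of mesh 1 / (k + 1) below x. Each such function is constant on
    countably many half-open boxes. *)
Lemma continuous_measurable_rV n (f : 'rV[R]_n -> R) :
  continuous f -> measurable_fun setT f.
Proof.
move=> cf.
pose z k (x : 'rV[R]_n) : 'rV[int]_n := \row_i Num.floor (k.+1%:R * x 0 i).
pose g k (m : 'rV[int]_n) : 'rV[R]_n := \row_i ((m 0 i)%:~R / k.+1%:R).
apply: (@measurable_fun_cvg _ _ _ _ (fun k => f \o g k \o z k)).
  move=> k _ Y mY; rewrite setTI.
  have mbox m : measurable (\bigcap_(i in [set: 'I_n])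
      [set x : 'rV[R]_n | Num.floor (k.+1%:R * x 0 i) = m 0 i]).
    apply: fin_bigcap_measurable => // i _.
    have -> : [set x : 'rV[R]_n | Num.floor (k.+1%:R * x 0 i) = m 0 i] =
        (fun x : 'rV[R]_n => x 0 i) @^-1`
          `[(m 0 i)%:~R / k.+1%:R, (m 0 i + 1)%:~R / k.+1%:R[%classic.
      apply/seteqP; split=> x /=; rewrite in_itv/= ler_pdivrMr// ltr_pdivlMr//
        (mulrC (x 0 i)); last exact: floor_def.
      by move=> <-; exact: floor_itv.
    by rewrite -[X in measurable X]setTI; exact: measurable_coord.
  have -> : (f \o g k \o z k) @^-1` Y =
      \bigcup_(m in [set m | Y (f (g k m))]) \bigcap_(i in [set: 'I_n])
        [set x | Num.floor (k.+1%:R * x 0 i) = m 0 i].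
    apply/seteqP; split=> [x /= Yx|x [m /= Ym zm] /=].
      by exists (z k x) => // i _ /=; rewrite mxE.
    suff -> : z k x = m by [].
    by apply/rowP => i; rewrite mxE; exact: zm.
  by rewrite bigcup_mkcond; apply: countable_bigcupT_measurable => [|m];
    [exact: countableP|case: ifP => _; [exact: mbox|exact: measurable0]].
move=> x _; suff gz : g k (z k x) @[k --> \oo] --> x.
  exact: (cvg_comp _ _ gz (cf x)).
apply/cvg_ballP => e e0; near=> k; split => // i j.
rewrite ord1 /ball/= !mxE.
have k1 : 0 < k.+1%:R :> R by [].
have /andP[] := floor_itv (k.+1%:R * x 0 j); rewrite rmorphD/= => fl fu.
rewrite {1}(_ : x 0 j = k.+1%:R * x 0 j / k.+1%:R); last by rewrite mulrAC divff ?mul1r.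
rewrite -mulrBl normrM ger0_norm ?subr_ge0//.
rewrite ger0_norm ?invr_ge0 ?ltW// ltr_pdivrMr// (@lt_le_trans _ _ 1)//.
  by rewrite ltrBlDl.
by rewrite -ler_pdivrMr// div1r ltW//; near: k; exact: near_infty_natSinv_lt (PosNum e0).
Unshelve. all: by end_near.
Qed.

Lemma continuous_rV (T : topologicalType) n (h : T -> 'rV[R]_n) :
  (forall i, continuous (fun t => h t 0 i)) -> continuous h.
Proof.
move=> ch t; apply/cvg_ballP => e e0.
have : \forall u \near t, forall i, ball (h t 0 i) e (h u 0 i).
  by apply: filter_forall => i; exact: (cvg_ball (ch i t)).
by apply: filterS => u hu; split => // i j; rewrite ord1.
Qed.

Lemma is_derive_line (V : normedModType R) (f : V -> R) (x v : V) (t d : R) :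
  is_derive (t *: v + x) v f d -> is_derive t 1 (fun s => f (s *: v + x)) d.
Proof.
have E : (fun h => h^-1 *: (((fun s => f (s *: v + x)) \o shift t) (h *: 1) -
    f (t *: v + x))) =
  (fun h => h^-1 *: ((f \o shift (t *: v + x)) (h *: v) - f (t *: v + x))).
  apply/funext => h /=; congr (_ *: (f _ - _)).
  by rewrite [_ *: 1]mulr1 scalerDl addrA.
move=> [df fd]; split; first by rewrite /derivable E.
by rewrite -fd /derive E.
Qed.

Lemma line_is_derive (V : normedModType R) (f : V -> R) (x v : V) (d : R) :
  is_derive (0 : R) 1 (fun s => f (s *: v + x)) d -> is_derive x v f d.
Proof.
have E : (fun h => h^-1 *: (((fun s => f (s *: v + x)) \o shift 0) (h *: 1) -
    f ((0 : R) *: v + x))) =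
  (fun h => h^-1 *: ((f \o shift x) (h *: v) - f x)).
  apply/funext => h /=; rewrite scale0r add0r; congr (_ *: (f _ - _)).
  by rewrite [_ *: 1]mulr1 addr0.
move=> [df fd]; split; first by move: df; rewrite /derivable E.
by rewrite -fd /derive E.
Qed.

Lemma cons_rV0 n (z : R * 'rV[R]_n) : cons_rV z 0 0 = z.1.
Proof.
rewrite /cons_rV (_ : 0 = @lshift 1 n 0); last exact: val_inj.
by apply: etrans (row_mxEl _ _ _ _) _; rewrite mxE.
Qed.

Lemma cons_rV_lift n (z : R * 'rV[R]_n) j : cons_rV z 0 (lift 0 j) = z.2 0 j.
Proof.
rewrite /cons_rV (_ : lift 0 j = @rshift 1 n j); last exact: val_inj.
exact: row_mxEr.
Qed.

Lemma cons_rVD n (h a t : R) (v y : 'rV[R]_n) :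
  cons_rV (h * a + t, h *: v + y) = h *: cons_rV (a, v) + cons_rV (t, y).
Proof.
apply/rowP => i; rewrite [RHS]mxE [X in _ = X + _]mxE.
case: (unliftP 0 i) => [j|] ->; first by rewrite !cons_rV_lift/= !mxE.
by rewrite !cons_rV0.
Qed.

Lemma delta_cons0 n : delta_mx 0 0 = cons_rV (1, 0) :> 'rV[R]_n.+1.
Proof.
apply/rowP => i; case: (unliftP 0 i) => [j|] ->.
  by rewrite cons_rV_lift !mxE.
by rewrite cons_rV0 !mxE.
Qed.

Lemma delta_cons_lift n (j : 'I_n) :
  delta_mx 0 (lift 0 j) = cons_rV (0, delta_mx 0 j) :> 'rV[R]_n.+1.
Proof.
apply/rowP => i; case: (unliftP 0 i) => [k|] ->.
  by rewrite cons_rV_lift !mxE/= (inj_eq (@lift_inj _ _)).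
by rewrite cons_rV0 !mxE.
Qed.

Lemma continuous_consl n (y : 'rV[R]_n) : continuous (fun t : R => cons_rV (t, y)).
Proof.
apply: continuous_rV => i; case: (unliftP 0 i) => [j|] ->.
  by under eq_fun do rewrite cons_rV_lift; exact: cst_continuous.
by under eq_fun do rewrite cons_rV0; move=> t; exact: cvg_id.
Qed.

Lemma continuous_consr n (t : R) : continuous (fun y : 'rV[R]_n => cons_rV (t, y)).
Proof.
apply: continuous_rV => i; case: (unliftP 0 i) => [j|] ->.
  by under eq_fun do rewrite cons_rV_lift; exact: coord_continuous.
by under eq_fun do rewrite cons_rV0; exact: cst_continuous.
Qed.

Local Notation unif := (uniform_prob (@ltr01 R)).

Lemma integral_unif01 (g : R -> R) : measurable_fun setT g ->
  (\int[unif]_t (g t)%:E = \int[lebesgue_measure]_(t in `[0%R, 1%R]) (g t)%:E)%E.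
Proof.
move=> mg; have mg' : measurable_fun setT (EFin \o g) by exact/measurable_EFinP.
rewrite [LHS]integralE [RHS]integralE !integral_uniform//.
- by rewrite subr0 invr1 !mul1e.
- exact: measurable_funeneg.
- exact: measurable_funepos.
Qed.

Lemma integral_unif_derive0 (F g : R -> R) : continuous g ->
  (forall t : R, is_derive t 1 F (g t)) -> F 1 = F 0 ->
  (\int[unif]_t (g t)%:E = 0)%E.
Proof.
move=> cg dF F10; rewrite integral_unif01; last exact: continuous_measurable_fun.
rewrite (@continuous_FTC2 _ _ F)//.
- by rewrite F10 subee.
- by apply: continuous_subspaceT.
- have cF : continuous F.
    by move=> t; apply/differentiable_continuous/derivable1_diffP; have [] := dF t.
  split=> [t _| |]; [by have [] := dF t|exact/cvg_at_right_filter/cF|exact/cvg_at_left_filter/cF].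
- by move=> t _; rewrite derive1E; have [] := dF t.
Qed.

Lemma torus_bounded_integrable n (f : 'rV[R]_n -> R) (M : R) :
  measurable_fun setT f -> (forall x, `|f x| <= M) ->
  (torus_measure n).-integrable setT (EFin \o f).
Proof.
move=> mf fM; apply: measurable_bounded_integrable => //.
  by have /= := @probability_setT _ _ _ (torus_measure n); rewrite /setT => ->; rewrite ltry.
by exists M; split; [exact: num_real|move=> N MN x _; exact: le_trans (fM x) (ltW MN)].
Qed.

(** Both orders are recorded because [integral_partial0] wants the direction of differentiation
    integrated innermost. *)
Lemma integral_torusS n (f : 'rV[R]_n.+1 -> R) (M : R) :
  measurable_fun setT f -> (forall x, `|f x| <= M) ->
  (\int[torus_measure n.+1]_x (f x)%:E =
   \int[unif]_t \int[torus_measure n]_y (f (cons_rV (t, y)))%:E)%E /\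
  (\int[torus_measure n.+1]_x (f x)%:E =
   \int[torus_measure n]_y \int[unif]_t (f (cons_rV (t, y)))%:E)%E.
Proof.
move=> mf fM.
have mfc : measurable_fun setT (f \o @cons_rV R n).
  by apply: measurableT_comp => //; exact: measurable_cons_rV.
have ifc : (unif \x torus_measure n)%E.-integrable setT (EFin \o (f \o @cons_rV R n)).
  apply: measurable_bounded_integrable => //.
    have /= := @probability_setT _ _ _ (unif \x torus_measure n)%E.
    by rewrite /setT => ->; rewrite ltry.
  exists M; split; first exact: num_real.
  by move=> N MN x _; exact: le_trans (fM _) (ltW MN).
have E : (\int[torus_measure n.+1]_x (f x)%:E =
   \int[unif \x torus_measure n]_z (f (cons_rV z))%:E)%E.
  by rewrite /=/distribution integral_pushforward//=; exact/measurable_EFinP.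
by rewrite E; split; [rewrite -integral12_prod_meas1//|rewrite -integral21_prod_meas1].
Qed.

(** Periodicity is asked in direction [i] only and the derivative is a separate function [g], so
    that the hypotheses survive freezing the first coordinate and induction on the dimension
    applies. In direction 0 the inner integral vanishes by the fundamental theorem of calculus on
    [0, 1]. *)
Lemma integral_partial0 n (i : 'I_n) (f g : 'rV[R]_n -> R) (M : R) :
  continuous g -> (forall x, `|g x| <= M) ->
  (forall x, is_derive x (delta_mx 0 i) f (g x)) ->
  (forall x, f (x + delta_mx 0 i) = f x) ->
  (\int[torus_measure n]_x (g x)%:E = 0)%E.
Proof.
elim: n i f g => [[]//|n IHn] i f g cg gM dfg fP.
have [E1 E2] := integral_torusS (continuous_measurable_rV cg) gM.
case: (unliftP 0 i) => [j|] ei; rewrite ei in dfg fP.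
  rewrite E1 integral0_eq// => t _.
  apply: (IHn j (fun y => f (cons_rV (t, y)))) => //.
  - by move=> y; apply: continuous_comp; [exact: continuous_consr|exact: cg].
  - move=> y; apply: line_is_derive.
    have -> : (fun s : R => f (cons_rV (t, s *: delta_mx 0 j + y))) =
              fun s => f (s *: delta_mx 0 (lift 0 j) + cons_rV (t, y)).
      apply/funext => s; rewrite delta_cons_lift -cons_rVD.
      by rewrite mulr0 add0r.
    by apply: is_derive_line; rewrite scale0r add0r.
  - move=> y; rewrite -[in RHS]fP; congr f.
    rewrite [RHS]addrC delta_cons_lift -[X in _ = X + _]scale1r -cons_rVD.
    by rewrite scale1r mulr0 add0r addrC.
rewrite E2 integral0_eq// => y _.
apply: (@integral_unif_derive0 (fun t => f (cons_rV (t, y)))).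
- by move=> t; apply: continuous_comp; [exact: continuous_consl|exact: cg].
- move=> t; have -> : (fun s : R => f (cons_rV (s, y))) =
              fun s => f (s *: delta_mx 0 0 + cons_rV (0, y)).
    apply/funext => s; rewrite delta_cons0 -cons_rVD.
    by rewrite scaler0 add0r mulr1 addr0.
  apply: is_derive_line.
  have -> : t *: delta_mx 0 0 + cons_rV (0, y) = cons_rV (t, y).
    by rewrite delta_cons0 -cons_rVD scaler0 add0r mulr1 addr0.
  exact: dfg.
- rewrite -(fP (cons_rV (0, y))); congr f.
  by rewrite delta_cons0 [RHS]addrC -[X in _ = X + _]scale1r -cons_rVD scaler0 add0r mulr1 addr0.
Qed.
End torus_integral.

(** * Trigonometric kernels *)

Section differentiability.
Context {R : realType}.

Lemma CkW (V : normedModType R) k (f : V -> R) : Ck k.+1 f -> Ck k f.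
Proof.
elim: k f => [|k IHk] f [cf df]; first exact: cf.
by split=> // v; have [dfv Cv] := df v; split=> //; exact: IHk.
Qed.

Lemma Ck_continuous (V : normedModType R) k (f : V -> R) : Ck k f -> continuous f.
Proof. by case: k => [//|k []]. Qed.

Lemma Ck_cst (V : normedModType R) k (c : R) : Ck k (fun _ : V => c).
Proof.
elim: k c => [|k IHk] c /=; first exact: cst_continuous.
split=> [|v]; first exact: cst_continuous.
split=> [x|]; first exact: derivable_cst.
by under eq_fun do rewrite derive_cst; exact: IHk.
Qed.

Lemma CkD (V : normedModType R) k (f g : V -> R) :
  Ck k f -> Ck k g -> Ck k (fun x => f x + g x).
Proof.
elim: k f g => [|k IHk] f g; first by move=> cf cg x; apply: continuousD; [exact: cf|exact: cg].
move=> [cf df] [cg dg]; split=> [x|v]; first by apply: continuousD; [exact: cf|exact: cg].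
have [dfv Cf] := df v; have [dgv Cg] := dg v.
split=> [x|]; first by apply: derivableD; [exact: dfv|exact: dgv].
rewrite (_ : (fun x => _) = fun x => 'D_v f x + 'D_v g x); first exact: IHk.
by apply/funext => x; apply: deriveD; [exact: dfv|exact: dgv].
Qed.

Lemma CkM (V : normedModType R) k (f g : V -> R) :
  Ck k f -> Ck k g -> Ck k (fun x => f x * g x).
Proof.
elim: k f g => [|k IHk] f g; first by move=> cf cg x; apply: continuousM; [exact: cf|exact: cg].
move=> Cf Cg; have [cf df] := Cf; have [cg dg] := Cg.
split=> [x|v]; first by apply: continuousM; [exact: cf|exact: cg].
have [dfv Cfv] := df v; have [dgv Cgv] := dg v.
split=> [x|]; first by apply: derivableM; [exact: dfv|exact: dgv].
rewrite (_ : (fun x => _) = fun x => f x * 'D_v g x + g x * 'D_v f x).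
  by apply: CkD; apply: IHk => //; exact: CkW.
by apply/funext => x; apply: deriveM; [exact: dfv|exact: dgv].
Qed.

Lemma CkZ (V : normedModType R) k (c : R) (f : V -> R) :
  Ck k f -> Ck k (fun x => c * f x).
Proof. by move=> Cf; apply: (@CkM V k (fun=> c)) => //; exact: Ck_cst. Qed.

Lemma Ck_exp (V : normedModType R) k (f : V -> R) m :
  Ck k f -> Ck k (fun x => f x ^+ m).
Proof.
move=> Cf; elim: m => [|m IHm].
  by under eq_fun do rewrite expr0; exact: Ck_cst.
by under eq_fun do rewrite exprS; exact: CkM.
Qed.

Lemma Ck_prod (V : normedModType R) k (I : Type) (r : seq I) (P : pred I)
    (f : I -> V -> R) :
  (forall i, Ck k (f i)) -> Ck k (fun x => \prod_(i <- r | P i) f i x).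
Proof.
move=> Cf; elim: r => [|i r IHr].
  by under eq_fun do rewrite big_nil; exact: Ck_cst.
under eq_fun do rewrite big_cons.
by case: (P i) => //; exact: CkM.
Qed.

Lemma is_derive_coord_cos n (i : 'I_n) (c : R) (x v : 'rV[R]_n) :
  is_derive x v (fun x => cos (pi * (x 0 i - c)))
    (- (pi * v 0 i) * sin (pi * (x 0 i - c))).
Proof.
apply: line_is_derive.
rewrite (_ : (fun s => _) = cos \o (fun s : R => pi * (s * v 0 i + (x 0 i - c)))).
  by apply: is_derive_eq; rewrite /GRing.scale/= mul0r add0r; ring.
by apply/funext => s /=; rewrite !mxE addrA.
Qed.

Lemma is_derive_coord_sin n (i : 'I_n) (c : R) (x v : 'rV[R]_n) :
  is_derive x v (fun x => sin (pi * (x 0 i - c)))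
    (pi * v 0 i * cos (pi * (x 0 i - c))).
Proof.
apply: line_is_derive.
rewrite (_ : (fun s => _) = sin \o (fun s : R => pi * (s * v 0 i + (x 0 i - c)))).
  by apply: is_derive_eq; rewrite /GRing.scale/= mul0r add0r; ring.
by apply/funext => s /=; rewrite !mxE addrA.
Qed.

Lemma coord_trig_continuous n (i : 'I_n) (c : R) :
  continuous (fun x : 'rV[R]_n => pi * (x 0 i - c)).
Proof.
move=> x.
apply: (@continuousM _ _ (fun=> pi) (fun x : 'rV[R]_n => x 0 i - c)).
  exact: cst_continuous.
apply: (@continuousB _ _ _ (fun x : 'rV[R]_n => x 0 i) (fun=> c)).
  exact: coord_continuous.
exact: cst_continuous.
Qed.

Lemma Ck_coord_trig n (i : 'I_n) (c : R) k :
  Ck k (fun x : 'rV[R]_n => cos (pi * (x 0 i - c))) /\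
  Ck k (fun x : 'rV[R]_n => sin (pi * (x 0 i - c))).
Proof.
have cc : continuous (fun x : 'rV[R]_n => cos (pi * (x 0 i - c))).
  by move=> x; apply: continuous_comp; [exact: coord_trig_continuous|exact: continuous_cos].
have cs : continuous (fun x : 'rV[R]_n => sin (pi * (x 0 i - c))).
  by move=> x; apply: continuous_comp; [exact: coord_trig_continuous|exact: continuous_sin].
elim: k => [//|k [IHc IHs]]; split; split=> // v; split=> [x|].
- by have [] := is_derive_coord_cos i c x v.
- rewrite [X in Ck k X](_ : _ = fun x : 'rV[R]_n => - (pi * v 0 i) * sin (pi * (x 0 i - c))).
    exact: CkZ.
  by apply/funext => x; have [] := is_derive_coord_cos i c x v.
- by have [] := is_derive_coord_sin i c x v.
- rewrite [X in Ck k X](_ : _ = fun x : 'rV[R]_n => pi * v 0 i * cos (pi * (x 0 i - c))).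
    exact: CkZ.
  by apply/funext => x; have [] := is_derive_coord_sin i c x v.
Qed.

End differentiability.

(** * Products of even cosine powers and their derivatives *)

Section kernel.
Context {R : realType} {n : nat}.
Implicit Types (x y : 'rV[R]_n) (N : 'I_n -> nat) (i j : 'I_n).

(* The second derivative of cos^(2 m) is a combination of cos^(2 m) and
   cos^(2 (m - 1)), which is what makes the recursion in N close. *)
Definition kern N y x : R := \prod_i cos (pi * (x 0 i - y 0 i)) ^+ (N i).*2.

Definition kern' N i y x : R :=
  \prod_(j | j != i) cos (pi * (x 0 j - y 0 j)) ^+ (N j).*2.

Definition decr N i : 'I_n -> nat := fun j => if j == i then (N i).-1 else N j.

Lemma kern_split N i y x :
  kern N y x = cos (pi * (x 0 i - y 0 i)) ^+ (N i).*2 * kern' N i y x.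
Proof. by rewrite /kern (bigD1 i). Qed.

Lemma kern_decr N i y x :
  kern (decr N i) y x = cos (pi * (x 0 i - y 0 i)) ^+ (N i).-1.*2 * kern' N i y x.
Proof.
rewrite (kern_split _ i) /decr eqxx; congr (_ * _).
by apply: eq_bigr => j /negbTE ->.
Qed.

Lemma smooth_kern N y : smooth (kern N y).
Proof.
by move=> k; apply: Ck_prod => i; apply: Ck_exp; case: (Ck_coord_trig i (y 0 i) k).
Qed.

(** Adding 1 to the argument only flips the sign of the cosine, and the even power removes the sign.
    This is why the kernels have period 1 although their frequency is pi. *)
Lemma cos_periodic_even (t : R) (k : int) (m : nat) :
  cos (pi * (t + k%:~R)) ^+ m.*2 = cos (pi * t) ^+ m.*2.
Proof.
rewrite -!muln2 mulnC !exprM; congr (_ ^+ m).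
have H (j : nat) (s : R) : cos (pi * (s + j%:R)) ^+ 2 = cos (pi * s) ^+ 2.
  elim: j => [|j IHj]; first by rewrite addr0.
  by rewrite -addn1 natrD addrA mulrDr mulr1 cosDpi sqrrN.
case: k => k; first exact: H.
by rewrite NegzE mulrNz -[in RHS](subrK k.+1%:R t) H.
Qed.

Lemma kern_periodic N y : Defs.periodic (kern N y).
Proof.
move=> x k; apply: eq_bigr => i _.
by rewrite !mxE addrAC cos_periodic_even.
Qed.

Lemma kern_ge0 N y x : 0 <= kern N y x.
Proof. by apply: prodr_ge0 => i _; rewrite exprn_even_ge0// odd_double. Qed.

Lemma cosX_even_le1 (t : R) m : cos t ^+ m.*2 <= 1.
Proof.
by rewrite -muln2 mulnC exprM exprn_ile1// ?sqr_ge0.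
Qed.

Lemma is_derive_cosX m (c K s : R) :
  is_derive s 1 (fun s => cos (pi * (s + c)) ^+ m * K)
    (- (m%:R * pi * cos (pi * (s + c)) ^+ m.-1 * sin (pi * (s + c)) * K)).
Proof.
pose h := cos \o (fun s : R => pi * (s + c)).
have dh : is_derive s 1 h (- sin (pi * (s + c)) * pi).
  by apply: is_derive_eq; rewrite /GRing.scale/=; ring.
suff : is_derive s 1 (h ^+ m * cst K)
    (- (m%:R * pi * cos (pi * (s + c)) ^+ m.-1 * sin (pi * (s + c)) * K)).
  congr is_derive; apply/funext => t.
  by rewrite /= -[LHS]/((h ^+ m) t * K) exprfctE.
by apply: is_derive_eq; rewrite /GRing.scale/= /h/=; ring.
Qed.

Lemma is_derive_cosXsin m (c K s : R) :
  is_derive s 1 (fun s => cos (pi * (s + c)) ^+ m * sin (pi * (s + c)) * K)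
    (pi * (cos (pi * (s + c)) ^+ m.+1 -
      m%:R * cos (pi * (s + c)) ^+ m.-1 * sin (pi * (s + c)) ^+ 2) * K).
Proof.
pose h := cos \o (fun s : R => pi * (s + c)).
pose g := sin \o (fun s : R => pi * (s + c)).
have dh : is_derive s 1 h (- sin (pi * (s + c)) * pi).
  by apply: is_derive_eq; rewrite /GRing.scale/=; ring.
have dg : is_derive s 1 g (cos (pi * (s + c)) * pi).
  by apply: is_derive_eq; rewrite /GRing.scale/=; ring.
suff : is_derive s 1 (h ^+ m * g * cst K)
    (pi * (cos (pi * (s + c)) ^+ m.+1 -
      m%:R * cos (pi * (s + c)) ^+ m.-1 * sin (pi * (s + c)) ^+ 2) * K).
  congr is_derive; apply/funext => t.
  by rewrite /= -[LHS]/((h ^+ m) t * g t * K) exprfctE.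
apply: is_derive_eq; rewrite /GRing.scale/= exprfctE /h/g/= exprS.
ring.
Qed.

Lemma kern'_line N i y x s : kern' N i y (s *: delta_mx 0 i + x) = kern' N i y x.
Proof.
by apply: eq_bigr => j /negbTE ji; rewrite !mxE ji andbF mulr0 add0r.
Qed.

Lemma coord_line i x s : (s *: delta_mx 0 i + x) 0 i = s + x 0 i.
Proof. by rewrite !mxE !eqxx mulr1. Qed.

Lemma is_derive_kern N i y x :
  is_derive x (delta_mx 0 i) (kern N y)
    (- ((N i).*2%:R * pi) * (cos (pi * (x 0 i - y 0 i)) ^+ (N i).*2.-1 *
        sin (pi * (x 0 i - y 0 i)) * kern' N i y x)).
Proof.
apply: line_is_derive.
rewrite (_ : (fun s => _) = fun s : R =>
    cos (pi * (s + (x 0 i - y 0 i))) ^+ (N i).*2 * kern' N i y x).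
  have := is_derive_cosX (N i).*2 (x 0 i - y 0 i) (kern' N i y x) 0.
  by rewrite add0r; congr is_derive; ring.
by apply/funext => s; rewrite (kern_split _ i) kern'_line coord_line addrA.
Qed.

Lemma derive_kern N i y x :
  'D_(delta_mx 0 i) (kern N y) x =
    - ((N i).*2%:R * pi) * (cos (pi * (x 0 i - y 0 i)) ^+ (N i).*2.-1 *
        sin (pi * (x 0 i - y 0 i)) * kern' N i y x).
Proof. by have [] := is_derive_kern N i y x. Qed.

Lemma is_derive_kern2 N i y x :
  is_derive x (delta_mx 0 i) ('D_(delta_mx 0 i) (kern N y))
    (pi ^+ 2 * ((N i).*2%:R * ((N i).*2%:R - 1) * kern (decr N i) y x -
                (N i).*2%:R ^+ 2 * kern N y x)).
Proof.
apply: line_is_derive.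
rewrite (_ : (fun s => _) = fun s : R =>
    cos (pi * (s + (x 0 i - y 0 i))) ^+ (N i).*2.-1 *
    sin (pi * (s + (x 0 i - y 0 i))) * (- ((N i).*2%:R * pi) * kern' N i y x)).
  have := is_derive_cosXsin (N i).*2.-1 (x 0 i - y 0 i)
    (- ((N i).*2%:R * pi) * kern' N i y x) 0.
  rewrite add0r kern_decr (kern_split _ i); congr is_derive.
  case: (N i) => [|m]; first by rewrite !(mul0r, oppr0, mulr0, subr0, expr0n)/=; ring.
  rewrite sin2cos2 doubleS/= !exprS -[m.*2.+2%:R]natr1 -[m.*2.+1%:R]natr1; ring.
by apply/funext => s; rewrite derive_kern kern'_line coord_line addrA; ring.
Qed.

Lemma kern'_ge0 N i y x : 0 <= kern' N i y x.
Proof. by apply: prodr_ge0 => j _; rewrite exprn_even_ge0// odd_double. Qed.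

Lemma barrier_ineq (a B : R) N i y x : 0 < a -> 0 <= B ->
  let m := (N i)%:R in let s := Num.sqrt m in
  let k := B / (a * pi) in
  a * pi ^+ 2 * (m * (4 * m - 2 - s) * kern (decr N i) y x -
                 m * (4 * m + k ^+ 2 / s - s) * kern N y x) <=
  a * 'D_(delta_mx 0 i) ('D_(delta_mx 0 i) (kern N y)) x -
  B * `|'D_(delta_mx 0 i) (kern N y) x|.
Proof.
move=> a0 B0; set m := _%:R; set s := Num.sqrt m; set k := B / _; rewrite /=.
have -> : 'D_(delta_mx 0 i) ('D_(delta_mx 0 i) (kern N y)) x =
    pi ^+ 2 * ((N i).*2%:R * ((N i).*2%:R - 1) * kern (decr N i) y x -
                (N i).*2%:R ^+ 2 * kern N y x).
  by have [] := is_derive_kern2 N i y x.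
rewrite derive_kern kern_decr (kern_split _ i).
have -> : (N i).*2%:R = 2 * m by rewrite -muln2 natrM mulrC.
(* At exponent 0 the factor [m] annihilates both sides, including the term whose denominator [s] is
   0. *)
rewrite /s /m; case: (N i) => [|j]; first by rewrite !(mul0r, mulr0, oppr0, subr0, normr0, expr0n)/=.
set t := cos _; set z := sin _; set W := kern' _ _ _ _.
have W0 : 0 <= W := kern'_ge0 _ _ _ _.
set M : R := j.+1%:R; set r := Num.sqrt M.
have M0 : 0 < M by [].
have r0 : 0 < r by rewrite sqrtr_gt0.
have e0 : 0 <= t ^+ j.*2 by rewrite exprn_even_ge0// odd_double.
rewrite doubleS/= !(exprS t); set e := t ^+ j.*2 in e0 *.
have zt : z ^+ 2 = 1 - t ^+ 2 by exact: sin2cos2.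
have -> : `|- (2 * M * pi) * (t * e * z * W)| = 2 * M * pi * (`|t| * e * `|z| * W).
  by rewrite !normrM normrN !normrM (ger0_norm e0) (ger0_norm W0) (gtr0_norm M0)
    (ger0_norm (@pi_ge0 R)) (ger0_norm (ler0n R 2)).
have p0 : 0 < pi :> R := pi_gt0 R.
rewrite -subr_ge0.
(* The cross term is absorbed by completing the square
   (r |sin| - k |cos|)^2 / r. *)
have tt : `|t| ^+ 2 = t ^+ 2 by rewrite real_normK ?num_real.
have zz : `|z| ^+ 2 = 1 - t ^+ 2 by rewrite real_normK ?num_real.
suff -> : a * (pi ^+ 2 * (2 * M * (2 * M - 1) * (e * W) -
      (2 * M) ^+ 2 * (t * (t * e) * W))) - B * (2 * M * pi * (`|t| * e * `|z| * W)) -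
    a * pi ^+ 2 * (M * (4 * M - 2 - r) * (e * W) -
      M * (4 * M + k ^+ 2 / r - r) * (t * (t * e) * W)) =
    a * pi ^+ 2 * M * e * W * ((r * `|z| - k * `|t|) ^+ 2 / r).
  apply: mulr_ge0; last by rewrite divr_ge0 ?sqr_ge0 ?ltW.
  by do 4! [apply: mulr_ge0 => //]; rewrite ?sqr_ge0 ?ltW.
have EB : B = k * (a * pi) by rewrite /k divfK// mulf_neq0// gt_eqF.
clearbody k; rewrite EB.
rewrite sqrrB !exprMn zz tt; field.
by rewrite gt_eqF.
Qed.

Lemma kernC N y x : kern N y x = kern N x y.
Proof.
by apply: eq_bigr => i _; rewrite -cosN; congr (cos _ ^+ _); ring.
Qed.

End kernel.

(** * Constants of the recursion *)

Section barrier_constants.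
Context {R : realType}.

(** The product r(N) satisfies q(N_j) r(N) = p(N_j) r([decr N j]) for each j separately, so after
    summation over j it solves the recursion with equality, and induction on the sum of the
    exponents compares it with [m]. The vanishing of [p] and [q] at 0 discards the coordinates that
    [decr] cannot lower. *)
Lemma multi_index_bound n (p q : nat -> R) (m : ('I_n -> nat) -> R) :
  p 0%N = 0 -> q 0%N = 0 -> (forall l, 0 < p l.+1) -> (forall l, 0 < q l.+1) ->
  (forall N, \sum_i p (N i) * m (decr N i) <= (\sum_i q (N i)) * m N) ->
  (forall N, (forall i, N i = 0%N) -> 1 <= m N) ->
  forall N, \prod_i \prod_(l < N i) (p l.+1 / q l.+1) <= m N.
Proof.
move=> p0 q0 p_gt0 q_gt0 mS m0 N.
have [k] := ubnP (\sum_i N i)%N; elim: k => // k IHk in N *; rewrite ltnS => Nk.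
have [N0|/existsNP[i /eqP Ni]] := pselect (forall i, N i = 0%N).
  rewrite big1 ?m0// => i _; rewrite N0 big_ord0//.
set r := \prod_i _.
have q_ge0 l : 0 <= q l by case: l => [|l]; rewrite ?q0// ltW.
have sq : 0 < \sum_i q (N i).
  rewrite (bigD1 i)//= ltr_pwDl ?sumr_ge0//.
  by case: (N i) Ni => // l _; exact: q_gt0.
rewrite -(ler_pM2l sq) (le_trans _ (mS N))// mulr_suml.
apply: ler_sum => j _.
case Nj : (N j) => [|l]; first by rewrite p0 q0 !mul0r.
have -> : q l.+1 * r = p l.+1 * \prod_i \prod_(l < decr N j i) (p l.+1 / q l.+1).
  rewrite /r (bigD1 j)//= [in RHS](bigD1 j)//= Nj big_ord_recr/= /decr eqxx Nj/=.
  rewrite [X in _ = _ * (_ * X)](eq_bigr (fun i => \prod_(l < N i) (p l.+1 / q l.+1))).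
    by field; rewrite gt_eqF.
  by move=> i' /negbTE ->.
rewrite ler_pM2l//; apply: IHk; apply: leq_trans Nk.
rewrite (bigD1 j)//= [X in (_ < X)%N](bigD1 j)//= /decr eqxx Nj/=.
rewrite (eq_bigr (fun i => N i)) ?addSn// => i' /negbTE -> //.
Qed.

Variable k : R.

(* The coefficients of barrier_ineq, with l the exponent of the coordinate. *)
Definition bar_p (l : nat) : R := l%:R * (4 * l%:R - 2 - Num.sqrt l%:R).
Definition bar_q (l : nat) : R :=
  l%:R * (4 * l%:R + k ^+ 2 / Num.sqrt l%:R - Num.sqrt l%:R).

Lemma sqrt_nat l : let s : R := Num.sqrt l.+1%:R in
  [/\ s ^+ 2 = l.+1%:R, 1 <= s & s <= l.+1%:R].
Proof.
move=> s; have s2 : s ^+ 2 = l.+1%:R by rewrite sqr_sqrtr.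
have s1 : 1 <= s by rewrite -sqrtr1 ler_sqrt// ler1n.
by split=> //; rewrite -s2 expr2 ler_peMl// (le_trans ler01).
Qed.

Lemma bar_p_gt0 l : 0 < bar_p l.+1.
Proof.
have [s2 s1 sl] := sqrt_nat l; rewrite /bar_p.
have l1 : 1 <= l.+1%:R :> R by rewrite ler1n.
rewrite mulr_gt0//; lra.
Qed.

Lemma bar_q_gt0 l : 0 < bar_q l.+1.
Proof.
have [s2 s1 sl] := sqrt_nat l; rewrite /bar_q.
have l1 : 1 <= l.+1%:R :> R by rewrite ler1n.
have : 0 <= k ^+ 2 / Num.sqrt l.+1%:R by rewrite divr_ge0 ?sqr_ge0// (le_trans ler01).
move=> ks; rewrite mulr_gt0//; lra.
Qed.

(* The mean of cos^(2 j). *)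
Definition wallis (j : nat) : R := \prod_(l < j) ((2 * l%:R + 1) / (2 * l%:R + 2)).

Lemma wallisS j : wallis j.+1 = wallis j * ((2 * j%:R + 1) / (2 * j%:R + 2)).
Proof. by rewrite /wallis big_ord_recr. Qed.

Lemma wallis_gt0 j : 0 < wallis j.
Proof. by apply: prodr_gt0 => l _; rewrite divr_gt0// ltr_wpDl// mulr_ge0. Qed.

(* The factors of the quotient of the two products are at most
   1 + c (j + 1)^(-3/2), with c = (1 + 2 k^2) / 2. *)
Lemma wallis_bar_bound :
  exists2 C : R, 0 < C &
    forall j, wallis j <= C * \prod_(l < j) (bar_p l.+1 / bar_q l.+1).
Proof.
pose c := (1 + 2 * k ^+ 2) / 2.
have c0 : 0 <= c by rewrite divr_ge0// addr_ge0// mulr_ge0// sqr_ge0.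
have K0 : 0 <= k ^+ 2 := sqr_ge0 _.
exists (expR (4 * c)) => [|j]; first exact: expR_gt0.
(* The exponent is the telescoping form of the sum of the errors c (l + 1)^(-3/2): with s = sqrt (j
   + 1) and v = sqrt (j + 2), s^(-3) <= 4 (1/s - 1/v). It makes the induction close and stays below
   4 c. *)
suff H : wallis j <= expR (4 * c * (1 - (Num.sqrt j.+1%:R)^-1)) *
    \prod_(l < j) (bar_p l.+1 / bar_q l.+1).
  apply: le_trans H _; rewrite ler_wpM2r//.
    by apply: prodr_ge0 => l _; rewrite divr_ge0// ltW ?bar_p_gt0 ?bar_q_gt0.
  rewrite ler_expR mulrBr mulr1 lerBlDr lerDl mulr_ge0 ?invr_ge0 ?sqrtr_ge0//.
  by rewrite mulr_ge0.
elim: j => [|j IHj]; first by rewrite /wallis !big_ord0 sqrtr1 invr1 subrr mulr0 expR0 mulr1.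
rewrite /wallis !big_ord_recr/= -/(wallis j).
have [s2 s1 sl] := sqrt_nat j; have [v2 v1 vl] := sqrt_nat j.+1.
set s := Num.sqrt j.+1%:R in s2 s1 sl IHj *; set v := Num.sqrt _ in v2 v1 vl *.
have s0 : 0 < s by rewrite (lt_le_trans ltr01).
have v0 : 0 < v by rewrite (lt_le_trans ltr01).
pose rho := (2 * j%:R + 1) / (2 * j%:R + 2) * (bar_q j.+1 / bar_p j.+1).
have pq := conj (bar_p_gt0 j) (bar_q_gt0 j).
set P := \prod_(_ < _) _ in IHj *.
have P0 : 0 < P by apply: prodr_gt0 => l _; rewrite divr_gt0// ?bar_p_gt0 ?bar_q_gt0.
have -> : (2 * j%:R + 1) / (2 * j%:R + 2) = rho * (bar_p j.+1 / bar_q j.+1).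
  by rewrite /rho; field; rewrite !gt_eqF// ?pq.1 ?pq.2// ltr_wpDl// mulr_ge0.
have H : rho <= expR (4 * c * (s^-1 - v^-1)).
  apply: le_trans (expR_ge1Dx _); rewrite -lerBlDl.
  have jE : j%:R = s ^+ 2 - 1 by rewrite s2 -natr1 addrK.
  have d0 : s ^+ 2 <= 4 * s ^+ 2 - 2 - s by nra.
  have d1 : 0 < 4 * s ^+ 2 - 2 - s by rewrite (lt_le_trans _ d0)// exprn_gt0.
  apply: (@le_trans _ _ (c / s ^+ 3)).
    rewrite -subr_ge0.
    have -> : c / s ^+ 3 - (rho - 1) =
        (2 * c * (4 * s ^+ 2 - 2 - s) - s ^+ 2 - (2 * s ^+ 2 - 1) * k ^+ 2) /
        (2 * s ^+ 3 * (4 * s ^+ 2 - 2 - s)).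
      rewrite /rho /bar_p /bar_q -/s -s2 jE; field.
      by rewrite !gt_eqF ?exprn_gt0//; lra.
    rewrite divr_ge0//; last by rewrite !mulr_ge0 ?exprn_ge0// ltW.
    (* The value of [c] is dictated here: by [d0] the first term of the numerator is at least 2 c
       s^2 = s^2 + 2 k^2 s^2, and after the subtractions k^2 is left over. *)
    have -> : 2 * c = 1 + 2 * k ^+ 2 by rewrite /c mulrC divfK.
    have : 0 <= (1 + 2 * k ^+ 2) * (4 * s ^+ 2 - 2 - s - s ^+ 2).
      by rewrite mulr_ge0 ?subr_ge0// addr_ge0// mulr_ge0.
    nra.
  rewrite -mulrA mulrCA ler_wpM2l//.
  have v2s : v ^+ 2 = s ^+ 2 + 1 by rewrite v2 s2 -natr1.
  have sv : v * (v + s) <= 4 * s ^+ 2 by nra.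
  rewrite -subr_ge0.
  have -> : 4 * (s^-1 - v^-1) - (s ^+ 3)^-1 =
      (4 * s ^+ 2 - v * (v + s)) / (s ^+ 3 * v * (v + s)).
    have vs : v + s != 0 by rewrite gt_eqF// addr_gt0.
    have <- : 4 * s ^+ 2 * ((v - s) * (v + s)) = 4 * s ^+ 2.
      by rewrite -subr_sqr v2s addrAC subrr add0r mulr1.
    by field; rewrite vs !gt_eqF.
  by rewrite divr_ge0 ?subr_ge0// !mulr_ge0// ?exprn_ge0 ?addr_ge0// ltW.
have -> : 4 * c * (1 - v^-1) = 4 * c * (1 - s^-1) + 4 * c * (s^-1 - v^-1) by ring.
have x0 : 0 <= bar_p j.+1 / bar_q j.+1 by rewrite divr_ge0// ltW// ?pq.1 ?pq.2.
rewrite expRD [leLHS]mulrA [leRHS]mulrA ler_wpM2r//.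
rewrite [leRHS]mulrAC ler_pM ?(ltW (wallis_gt0 _))//.
by rewrite /rho mulr_ge0// divr_ge0 ?(ltW pq.1) ?(ltW pq.2)// addr_ge0// mulr_ge0.
Qed.

End barrier_constants.

(** * Periodic functions *)

(* Measurability is not needed because the integral of a nonnegative function is
   a supremum over the simple functions below it; this is applied to an
   integrand containing the drift, whose measurability is never proved. *)
Lemma le_integral_pointwise d (T : measurableType d) (R : realType)
    (mu : {measure set T -> \bar R}) (f g : T -> \bar R) :
  (forall x, f x <= g x)%E -> (\int[mu]_x f x <= \int[mu]_x g x)%E.
Proof.
move=> fg.
have H (h k : T -> \bar R) : (forall x, 0 <= h x)%E -> (forall x, 0 <= k x)%E ->
    (forall x, h x <= k x)%E -> (\int[mu]_x h x <= \int[mu]_x k x)%E.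
  move=> h0 k0 hk; rewrite !ge0_integralTE//; apply: le_ereal_sup.
  move=> _ [s /= sh <-]; exists s => // x; exact: le_trans (sh x) (hk x).
rewrite [leLHS]integralE [leRHS]integralE; apply: leeB; apply: H => // x.
  by apply: (@funepos_le _ _ setT) => [z _|]; [exact: fg|exact: in_setT].
by apply: (@funeneg_le _ _ setT) => [z _|]; [exact: fg|exact: in_setT].
Qed.

Section torus_functions.
Context {R : realType} {n : nat}.
Implicit Types (x y v : 'rV[R]_n) (f g : 'rV[R]_n -> R) (i : 'I_n).

Let unit_cube := [set x : 'rV[R]_n | forall i, `[0%R, 1%R]%classic (x 0 i)].

Lemma unit_cube_compact : compact unit_cube.
Proof.
by apply: (@rV_compact R n (fun=> `[0%R, 1%R]%classic)) => i; exact: segment_compact.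
Qed.

Lemma unit_cube_translate x : exists k, unit_cube (x + map_mx intr k).
Proof.
exists (\row_i - Num.floor (x 0 i)) => i; rewrite /= in_itv/= !mxE rmorphN/=.
have /andP[] := floor_itv (x 0 i); rewrite rmorphD/= => l u.
by rewrite subr_ge0 l/= lerBlDl ltW.
Qed.

Lemma periodic_bounded f : continuous f -> Defs.periodic f ->
  exists M : R, forall x, `|f x| <= M.
Proof.
move=> cf pf.
have : compact (f @` unit_cube).
  apply: continuous_compact unit_cube_compact; exact: continuous_subspaceT.
move=> /compact_bounded[M [_ MA]]; exists (M + 1) => x.
have [k kx] := unit_cube_translate x.
rewrite -(pf x k); apply: (MA (M + 1)); first by rewrite ltrDl.
by exists (x + map_mx intr k).
Qed.

Lemma periodicD_delta (T : Type) (f : 'rV[R]_n -> T) i x : Defs.periodic f ->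
  f (x + delta_mx 0 i) = f x.
Proof. by move=> /(_ x (delta_mx 0 i)); rewrite map_delta_mx. Qed.

Lemma periodic_derive f v : Defs.periodic f -> Defs.periodic ('D_v f).
Proof.
move=> pf x k; rewrite /derive.
have -> // : (fun h => h^-1 *: ((f \o shift (x + map_mx intr k)) (h *: v) -
    f (x + map_mx intr k))) = (fun h => h^-1 *: ((f \o shift x) (h *: v) - f x)).
by apply/funext => h /=; rewrite addrA !pf.
Qed.

Lemma Ck1_derive_continuous f v : Ck 1 f -> continuous ('D_v f).
Proof. by move=> [_ /(_ v)[]]. Qed.

Lemma Ck1_derivable f x v : Ck 1 f -> derivable f x v.
Proof. by move=> [_ /(_ v)[]]. Qed.

Lemma integral_derive0 f i : Ck 1 f -> Defs.periodic f ->
  (\int[torus_measure n]_x ('D_(delta_mx 0 i) f x)%:E = 0)%E.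
Proof.
move=> Cf pf; have cg : continuous ('D_(delta_mx 0 i) f) by exact: Ck1_derive_continuous.
have pg : Defs.periodic ('D_(delta_mx 0 i) f) by exact: periodic_derive.
have [M gM] := periodic_bounded cg pg.
apply: (integral_partial0 (i := i) (f := f)) => //.
- by move=> x; apply/derivableP; exact: Ck1_derivable.
- by move=> x; exact: periodicD_delta.
Qed.

Lemma torus_integrable f : continuous f -> Defs.periodic f ->
  (torus_measure n).-integrable setT (EFin \o f).
Proof.
move=> cf pf; have [M fM] := periodic_bounded cf pf.
exact: torus_bounded_integrable (continuous_measurable_rV cf) fM.
Qed.

Lemma torus_integrableM f g : (torus_measure n).-integrable setT (EFin \o f) ->
  continuous g -> Defs.periodic g ->
  (torus_measure n).-integrable setT (fun x => (f x * g x)%:E).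
Proof.
move=> intf cg pg; have [M gM] := periodic_bounded cg pg.
have -> : (fun x => (f x * g x)%:E) = ((EFin \o f) \* (EFin \o g))%E.
  by apply/funext => x; rewrite /= EFinM.
apply: integrableMl => //; first exact: continuous_measurable_rV.
by exists M; split; [exact: num_real|move=> N MN x _; exact: le_trans (gM x) (ltW MN)].
Qed.

Lemma enorm_sqr v : enorm v ^+ 2 = \sum_i v 0 i ^+ 2.
Proof.
rewrite /enorm sqr_sqrtr; first by apply: eq_bigr => i _; rewrite expr2.
by apply: sumr_ge0 => i _; rewrite -expr2 sqr_ge0.
Qed.

Lemma sum_continuous (I : Type) (r : seq I) (F : I -> 'rV[R]_n -> R) :
  (forall j : I, continuous (F j)) -> continuous (fun x => \sum_(j <- r) F j x).
Proof.
move=> cF; elim: r => [|i r IHr] x.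
  by under eq_fun do rewrite big_nil; exact: cst_continuous.
under eq_fun do rewrite big_cons.
by apply: continuousD; [exact: cF|exact: IHr].
Qed.

Lemma continuous_sqr f : continuous f -> continuous (fun x => f x ^+ 2).
Proof. by move=> cf x; apply: continuousM; exact: cf. Qed.

Lemma normr_continuous f : continuous f -> continuous (fun x => `|f x|).
Proof.
move=> cf x; apply: (@continuous_comp _ _ _ f Num.norm); first exact: cf.
exact: (@norm_continuous R R^o (f x)).
Qed.

Lemma measurable_rV d (T : measurableType d) (g : T -> 'rV[R]_n) :
  (forall i, measurable_fun setT (fun z : T => g z 0 i)) -> measurable_fun setT g.
Proof.
move=> mg; apply: (@measurability _ _ _ _ _ _
  (\big[setU/set0]_(i < n)
    preimage_set_system setT (fun x : 'rV[R]_n => x 0 i) measurable)) => //.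
move=> _ [B + <-]; rewrite -bigcup_seq => -[i _ [C mC <-]].
by rewrite !setTI; have := mg i measurableT C mC; rewrite setTI.
Qed.

(** This admits the kernels as test functions in [weak_fokker_planck]. The classical gradient is the
    weak one because the partial derivatives of the periodic product [f x * phi x] have mean
    zero. *)
Lemma sobolev12_Ck1 f : Ck 1 f -> Defs.periodic f -> sobolev12 f (grad f).
Proof.
move=> Cf pf; have cf := Ck_continuous Cf.
have cg i : continuous ('D_(delta_mx 0 i) f) by exact: Ck1_derive_continuous.
have pg i : Defs.periodic ('D_(delta_mx 0 i) f) by exact: periodic_derive.
split => //.
- exact: continuous_measurable_rV.
- apply: (@torus_integrable (fun x => f x ^+ 2)).
    exact: continuous_sqr.
  by move=> x k; rewrite pf.
- by move=> x k; apply/rowP => i; rewrite !mxE; exact: pg.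
- by apply: measurable_rV => i; under eq_fun do rewrite mxE; exact: continuous_measurable_rV.
- apply: (@torus_integrable (fun x => enorm (grad f x) ^+ 2)).
    under eq_fun do rewrite enorm_sqr.
    apply: sum_continuous => i; under eq_fun do rewrite mxE.
    exact: (@continuous_sqr ('D_(delta_mx 0 i) f)).
  move=> x k; rewrite !enorm_sqr; apply: eq_bigr => i _.
  by rewrite !mxE [X in X ^+ 2 = _]pg.
- move=> phi i pphi sphi.
  have Cphi : Ck 1 phi := sphi 1%N.
  have cphi := Ck_continuous Cphi.
  have cgphi : continuous ('D_(delta_mx 0 i) phi) by exact: Ck1_derive_continuous.
  have pgphi : Defs.periodic ('D_(delta_mx 0 i) phi) by exact: periodic_derive.
  have pfphi : Defs.periodic (fun x => f x * phi x) by move=> x k; rewrite pf pphi.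
  have H := integral_derive0 i (CkM Cf Cphi) pfphi.
  have I1 : (torus_measure n).-integrable setT
      (fun x => (f x * grad phi x 0 i)%:E).
    under eq_fun do rewrite mxE.
    by apply: torus_integrableM => //; exact: torus_integrable.
  have I2 : (torus_measure n).-integrable setT
      (fun x => (grad f x 0 i * phi x)%:E).
    under eq_fun do rewrite mxE.
    by apply: (torus_integrableM (f := 'D_(delta_mx 0 i) f)) => //; exact: torus_integrable.
  have : (\int[torus_measure n]_x (f x * grad phi x 0 i)%:E +
      \int[torus_measure n]_x (grad f x 0 i * phi x)%:E = 0)%E.
    have /= <- := integralD_EFin measurableT I1 I2; rewrite -[RHS]H.
    apply: eq_integral => x _; rewrite !mxE (deriveM (f := f) (g := phi)); [|exact: Ck1_derivable..].
    by rewrite /GRing.scale/= (mulrC (phi x)).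
  by move=> E0; rewrite -[RHS]sub0e -E0 addeK//; exact: integrable_fin_num I2.
Qed.

End torus_functions.

(** * Lower bound for the density on kernels *)

Section fokker_planck.
Context {R : realType} {n : nat}.
Implicit Types (x y v : 'rV[R]_n) (f : 'rV[R]_n -> R) (i : 'I_n).

Local Notation mu := (torus_measure n).

Lemma integrable_of_sqr f : measurable_fun setT f ->
  mu.-integrable setT (fun x => (f x ^+ 2)%:E) -> mu.-integrable setT (EFin \o f).
Proof.
move=> mf if2.
have i1 : mu.-integrable setT (fun x => (1 + f x ^+ 2)%:E).
  have -> : (fun x => (1 + f x ^+ 2)%:E) = (cst 1 \+ (fun x => (f x ^+ 2)%:E))%E.
    by apply/funext => x; rewrite /= EFinD.
  apply: integrableD => //; apply: (@torus_integrable _ _ (fun=> 1)) => //.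
  exact: cst_continuous.
apply: le_integrable i1 => //; first exact/measurable_EFinP.
move=> x _; rewrite /= lee_fin [leRHS]ger0_norm ?addr_ge0 ?sqr_ge0//.
have : 0 <= (`|f x| - 1) ^+ 2 := sqr_ge0 _.
rewrite sqrrB real_normK ?num_real// mulr1 expr1n mulr2n.
have : 0 <= `|f x| := normr_ge0 _.
lra.
Qed.

Lemma coord_sqr_le v i : v 0 i ^+ 2 <= enorm v ^+ 2.
Proof. by rewrite enorm_sqr (bigD1 i)//= lerDl sumr_ge0// => j _; exact: sqr_ge0. Qed.

Variables (sigma B : R) (b : 'rV[R]_n -> 'rV[R]_n) (theta : 'rV[R]_n -> R).
Hypothesis B0 : 0 <= B.
Hypothesis bB : forall x i, `|b x 0 i| <= B.
Hypothesis FP : weak_fokker_planck sigma b theta.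
Let a := sigma ^+ 2 / 2.

Lemma fp_integrable : measurable_fun setT theta /\ mu.-integrable setT (EFin \o theta).
Proof.
by have [g [_ mt t2 _ _ _ _] _] := FP; split=> //; exact: integrable_of_sqr.
Qed.

(** The weak gradient of [theta], tested against the smooth functions ['D_(delta_mx 0 i) phi], turns
    the diffusion term into an integral of [theta] times the Laplacian; the drift term is then
    estimated by its absolute value. *)
Lemma fp_subsolution phi : smooth phi -> Defs.periodic phi ->
  (\int[mu]_x (theta x * (a * laplacian phi x) -
     `|theta x| * (B * \sum_i `|'D_(delta_mx 0 i) phi x|))%:E <= 0)%E.
Proof.
move=> sphi pphi; have [mt it] := fp_integrable.
have [g [_ _ _ _ mg g2 weak] test] := FP.
have C1 := sphi 1%N.
have Cd i : smooth ('D_(delta_mx 0 i) phi) by move=> k; have [_ /(_ (delta_mx 0 i))[]] := sphi k.+1.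
have pd i : Defs.periodic ('D_(delta_mx 0 i) phi) by exact: periodic_derive.
have cd i : continuous ('D_(delta_mx 0 i) phi) := Cd i 0%N.
have pdd i : Defs.periodic ('D_(delta_mx 0 i) ('D_(delta_mx 0 i) phi)) by exact: periodic_derive.
have cdd i : continuous ('D_(delta_mx 0 i) ('D_(delta_mx 0 i) phi)).
  by apply: Ck1_derive_continuous; exact: Cd i 1%N.
have mgi i : measurable_fun setT (fun x => g x 0 i).
  exact: (measurableT_comp (measurable_coord i) mg).
have ig i : mu.-integrable setT (EFin \o (fun x => g x 0 i)).
  apply: integrable_of_sqr => //; apply: le_integrable g2 => //.
    by apply/measurable_EFinP; exact: measurable_funX.
  by move=> x _; rewrite /= lee_fin !ger0_norm ?sqr_ge0 ?coord_sqr_le.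
have igd i : mu.-integrable setT (fun x => (g x 0 i * 'D_(delta_mx 0 i) phi x)%:E).
  exact: torus_integrableM (ig i) (cd i) (pd i).
have itdd i : mu.-integrable setT
    (fun x => (theta x * 'D_(delta_mx 0 i) ('D_(delta_mx 0 i) phi) x)%:E).
  exact: torus_integrableM it (cdd i) (pdd i).
have cS : continuous (fun x => B * \sum_i `|'D_(delta_mx 0 i) phi x|).
  move=> x; apply: (@continuousM _ _ (fun=> B) (fun x => \sum_i `|'D_(delta_mx 0 i) phi x|)).
    exact: cst_continuous.
  apply: (sum_continuous (F := fun i x => `|'D_(delta_mx 0 i) phi x|)) => i.
  exact: normr_continuous.
have pS : Defs.periodic (fun x => B * \sum_i `|'D_(delta_mx 0 i) phi x|).
  by move=> x k; congr (_ * _); apply: eq_bigr => i _; rewrite [X in `|X|]pd.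
have inS : mu.-integrable setT
    (fun x => (`|theta x| * (B * \sum_i `|'D_(delta_mx 0 i) phi x|))%:E).
  exact: (torus_integrableM (f := fun x => `|theta x|) (integrable_norm it)).
have E : (\int[mu]_x (\sum_i (theta x * 'D_(delta_mx 0 i) ('D_(delta_mx 0 i) phi) x)%:E) =
    - \int[mu]_x (\sum_i (g x 0 i * 'D_(delta_mx 0 i) phi x)%:E))%E.
  rewrite !integral_sum// -fin_num_sumeN; last by move=> i _; exact: integrable_fin_num.
  apply: eq_bigr => i _; rewrite -(weak ('D_(delta_mx 0 i) phi) i (pd i) (Cd i)).
  by apply: eq_integral => x _; rewrite mxE.
have iL : mu.-integrable setT (fun x => (theta x * (a * laplacian phi x))%:E).
  apply: (torus_integrableM (f := theta) (g := fun x => a * laplacian phi x) it).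
    move=> x; apply: (@continuousM _ _ (fun=> a) (laplacian phi)).
      exact: cst_continuous.
    exact: (sum_continuous (F := fun i => 'D_(delta_mx 0 i) ('D_(delta_mx 0 i) phi))).
  move=> x k; congr (_ * _); apply: eq_bigr => i _; exact: pdd.
have GE x : (a * dotv (g x) (grad phi x))%:E =
    (a%:E * \sum_i (g x 0 i * 'D_(delta_mx 0 i) phi x)%:E)%E.
  by rewrite EFinM sumEFin; congr (_ * _%:E)%E; apply: eq_bigr => i _; rewrite mxE.
have iSg : mu.-integrable setT
    (fun x => \sum_i (g x 0 i * 'D_(delta_mx 0 i) phi x)%:E)%E.
  exact: integrable_sum.
have iG : mu.-integrable setT (fun x => (a * dotv (g x) (grad phi x))%:E).
  by under eq_fun do rewrite GE; exact: integrableZl.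
have E2 : (\int[mu]_x (theta x * (a * laplacian phi x))%:E =
           \int[mu]_x (- (a * dotv (g x) (grad phi x)))%:E)%E.
  transitivity (a%:E * \int[mu]_x (\sum_i
      (theta x * 'D_(delta_mx 0 i) ('D_(delta_mx 0 i) phi) x)%:E))%E.
    rewrite -integralZl//; last exact: integrable_sum.
    apply: eq_integral => x _; rewrite sumEFin -EFinM mulrCA; congr (_ * _)%:E.
    by rewrite mulr_sumr.
  rewrite E muleN -integralZl// -mulN1e -integralZl//; last exact: integrableZl.
  by apply: eq_integral => x _; rewrite -GE -EFinM mulN1r.
(* The 0 on the right is replaced by the weak equation tested at [phi], so that [b] enters only
   through a pointwise comparison of integrands. *)
have <- := test phi (grad phi) (sobolev12_Ck1 C1 pphi).
have iNG : mu.-integrable setT (fun x => (- (a * dotv (g x) (grad phi x)))%:E).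
  by under eq_fun do rewrite EFinN; exact: integrableN.
have /= -> := integralB_EFin measurableT iL inS.
rewrite E2; have /= <- := integralB_EFin measurableT iNG inS.
apply: le_integral_pointwise => x; rewrite lee_fin addrC lerD2r.
rewrite lerNl (le_trans (ler_norm _))// normrN normrM ler_wpM2l//.
rewrite (le_trans (ler_norm_sum _ _ _))// mulr_sumr ler_sum// => i _.
by rewrite normrM mxE ler_wpM2r.
Qed.

Hypothesis sigma0 : 0 < sigma.
Hypothesis theta_ge0 : {ae mu, forall x, 0 <= theta x}.
Hypothesis theta1 : (\int[mu]_x (theta x)%:E = 1)%E.
Let k := B / (a * pi).

Let a0 : 0 < a. Proof. by rewrite divr_gt0// exprn_gt0. Qed.

Lemma kern_integrable N y : mu.-integrable setT (fun x => (`|theta x| * kern N y x)%:E).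
Proof.
have [_ it] := fp_integrable.
apply: (torus_integrableM (f := fun x => `|theta x|) (integrable_norm it)).
  exact: (smooth_kern N y 0%N).
exact: kern_periodic.
Qed.

(** The density is nonnegative only almost everywhere, whereas the comparisons of integrands are
    made at every point; hence the passage to the absolute value. *)
Lemma abs_theta1 : (\int[mu]_x (`|theta x|)%:E = 1)%E.
Proof.
have [mt _] := fp_integrable.
rewrite -theta1; apply: ae_eq_integral => //.
- by apply/measurable_EFinP; exact: measurableT_comp.
- exact/measurable_EFinP.
- by apply: filterS theta_ge0 => x t0 _; rewrite ger0_norm.
Qed.

(** Multiplying [barrier_ineq] by |theta|, summing over i and integrating gives a quantity that
    [fp_subsolution] makes nonpositive. This is the recursion of [multi_index_bound] for the masses
    [m N], started at N = 0, where the kernel is 1 and the mass is 1. *)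
Lemma kern_lower_bound N y :
  ((\prod_i \prod_(l < N i) (bar_p l.+1 / bar_q k l.+1))%:E <=
   \int[mu]_x (`|theta x| * kern N y x)%:E)%E.
Proof.
pose m N := fine (\int[mu]_x (`|theta x| * kern N y x)%:E).
have mE N' : (\int[mu]_x (`|theta x| * kern N' y x)%:E)%E = (m N')%:E.
  by rewrite fineK//; exact: integrable_fin_num (kern_integrable N' y).
rewrite mE lee_fin; apply: multi_index_bound => //.
- by rewrite /bar_p mul0r.
- by rewrite /bar_q mul0r.
- by move=> l; exact: bar_p_gt0.
- by move=> l; exact: bar_q_gt0.
- move=> {}N.
  have c0 : 0 < a * pi ^+ 2 by rewrite mulr_gt0// exprn_gt0// pi_gt0.
  pose F i x := a * pi ^+ 2 * (bar_p (N i) * kern (decr N i) y x - bar_q k (N i) * kern N y x).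
  have le0 : (\int[mu]_x (`|theta x| * \sum_i F i x)%:E <= 0)%E.
    apply: le_trans (fp_subsolution (smooth_kern N y) (kern_periodic N y)).
    rewrite [leRHS](_ : _ = \int[mu]_x (`|theta x| * (a * laplacian (kern N y) x) -
        `|theta x| * (B * \sum_i `|'D_(delta_mx 0 i) (kern N y) x|))%:E)%E; last first.
      have mL : measurable_fun setT (fun x => a * laplacian (kern N y) x).
        apply: measurable_funM => //; apply: measurable_sum => i.
        apply: continuous_measurable_rV; apply: Ck1_derive_continuous.
        by have [_ /(_ (delta_mx 0 i))[]] := smooth_kern N y 2%N.
      have mS : measurable_fun setT
          (fun x => B * \sum_i `|'D_(delta_mx 0 i) (kern N y) x|).
        apply: measurable_funM => //; apply: measurable_sum => i.
        apply: continuous_measurable_rV; apply: normr_continuous.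
        exact: Ck1_derive_continuous (smooth_kern N y 1%N).
      have [mt _] := fp_integrable.
      have mat : measurable_fun setT (fun x => `|theta x|) by exact: measurableT_comp.
      apply: ae_eq_integral => //.
      - by apply/measurable_EFinP; apply: measurable_funB; exact: measurable_funM.
      - by apply/measurable_EFinP; apply: measurable_funB; exact: measurable_funM.
      - by apply: filterS theta_ge0 => x t0 _; rewrite (ger0_norm t0).
    apply: le_integral_pointwise => x; rewrite lee_fin -mulrBr ler_wpM2l//.
    rewrite !mulr_sumr -sumrB; apply: ler_sum => i _.
    exact: barrier_ineq.
  have E : (\int[mu]_x (`|theta x| * \sum_i F i x)%:E =
      (\sum_i (a * pi ^+ 2 * (bar_p (N i) * m (decr N i) - bar_q k (N i) * m N)))%:E)%E.
    transitivity (\int[mu]_x (\sum_i (`|theta x| * F i x)%:E))%E.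
      by apply: eq_integral => x _; rewrite sumEFin mulr_sumr.
    have iA i : mu.-integrable setT (fun x => (a * pi ^+ 2 * bar_p (N i) *
        (`|theta x| * kern (decr N i) y x))%:E).
      by under eq_fun do rewrite EFinM; apply: integrableZl => //; exact: kern_integrable.
    have iB i : mu.-integrable setT (fun x => (a * pi ^+ 2 * bar_q k (N i) *
        (`|theta x| * kern N y x))%:E).
      by under eq_fun do rewrite EFinM; apply: integrableZl => //; exact: kern_integrable.
    have FE i x : (`|theta x| * F i x)%:E = (a * pi ^+ 2 * bar_p (N i) *
        (`|theta x| * kern (decr N i) y x) - a * pi ^+ 2 * bar_q k (N i) *
        (`|theta x| * kern N y x))%:E.
      by congr (_%:E); rewrite /F; ring.
    rewrite integral_sum//; last first.
      move=> i; under eq_fun do rewrite FE EFinB.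
      exact: (integrableB measurableT (iA i) (iB i)).
    rewrite -sumEFin; apply: eq_bigr => i _.
    under eq_integral do rewrite FE.
    have /= -> := integralB_EFin measurableT (iA i) (iB i).
    under eq_integral do rewrite EFinM.
    under [X in (_ - X)%E]eq_integral do rewrite EFinM.
    rewrite !integralZl//; [|exact: kern_integrable..].
    by rewrite !mE -!EFinM -EFinB; congr (_%:E); ring.
  move: le0; rewrite E lee_fin -mulr_sumr pmulr_rle0// sumrB subr_le0.
  by rewrite mulr_suml.
- move=> {}N N0; rewrite -lee_fin -mE -abs_theta1.
  apply: le_integral_pointwise => x.
  by rewrite /kern big1 ?mulr1// => i _; rewrite N0 expr0.
Qed.

End fokker_planck.

(** * Integrals and concentration of the kernels *)

Section korovkin.
Context {R : realType} {n : nat}.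
Implicit Types (x y t : 'rV[R]_n) (F : 'rV[R]_n -> R) (i : 'I_n).

Local Notation mu := (torus_measure n).

Definition incr (N : 'I_n -> nat) i : 'I_n -> nat :=
  fun j => if j == i then (N i).+1 else N j.

Lemma decr_incr N i : decr (incr N i) i = N.
Proof. by apply/funext => j; rewrite /decr /incr eqxx; case: eqP => [->|]. Qed.

(** The factor sin^2, which measures the distance to [y] in coordinate [i], turns a kernel into a
    difference of two kernels; the second moments of the kernels thus follow from their explicit
    integrals. *)
Lemma kern_incr N i y x :
  kern N y x * (1 - cos (pi * (x 0 i - y 0 i)) ^+ 2) = kern N y x - kern (incr N i) y x.
Proof.
have := kern_decr (incr N i) i y x; rewrite decr_incr => ->.
rewrite (kern_split (incr N i) i) /incr eqxx doubleS !exprS/=; ring.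
Qed.

Lemma kern_torus_integrable N y : mu.-integrable setT (EFin \o kern N y).
Proof.
by apply: torus_integrable; [exact: (smooth_kern N y 0%N)|exact: kern_periodic].
Qed.

(** The second partial derivative of the kernel has mean zero, and its two-term formula then becomes
    the Wallis recursion. It is the counterpart, with equality and without drift, of the recursion
    for [theta]. *)
Lemma integral_kern_decr N i j y : N i = j.+1 ->
  (\int[mu]_x (kern N y x)%:E =
   ((2 * j%:R + 1) / (2 * j%:R + 2))%:E * \int[mu]_x (kern (decr N i) y x)%:E)%E.
Proof.
move=> Nij.
have C1 : Ck 1 ('D_(delta_mx 0 i) (kern N y)).
  by have [_ /(_ (delta_mx 0 i))[]] := smooth_kern N y 2%N.
have p1 : Defs.periodic ('D_(delta_mx 0 i) (kern N y)).
  exact/periodic_derive/kern_periodic.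
have := integral_derive0 i C1 p1.
pose c : R := pi ^+ 2 * ((2 * j%:R + 2) * (2 * j%:R + 1)).
pose d : R := pi ^+ 2 * (2 * j%:R + 2) ^+ 2.
have q0 : 0 < 2 * j%:R + 2 :> R by rewrite ltr_wpDl// mulr_ge0.
have d0 : d != 0 by rewrite /d mulf_neq0// expf_neq0// gt_eqF// pi_gt0.
under eq_integral => x _.
  have [_ ->] := is_derive_kern2 N i y x.
  have -> : pi ^+ 2 * ((N i).*2%:R * ((N i).*2%:R - 1) * kern (decr N i) y x -
      (N i).*2%:R ^+ 2 * kern N y x) = c * kern (decr N i) y x - d * kern N y x.
    by rewrite /c /d Nij -muln2 natrM -natr1; ring.
  rewrite EFinB !EFinM.
  over.
rewrite integralB//; [|by apply: integrableZl => //; exact: kern_torus_integrable..].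
rewrite !integralZl//; [|exact: kern_torus_integrable..].
have f1 := integrable_fin_num measurableT (kern_torus_integrable N y).
have f2 := integrable_fin_num measurableT (kern_torus_integrable (decr N i) y).
rewrite -(fineK f1) -(fineK f2) -!EFinM -EFinB => -[/eqP]; rewrite subr_eq0 => /eqP E.
congr (_%:E); apply: (mulfI d0); rewrite -E /c /d; field.
by rewrite gt_eqF.
Qed.

Lemma integral_kern N y :
  (\int[mu]_x (kern N y x)%:E = (\prod_i @wallis R (N i))%:E)%E.
Proof.
have [k] := ubnP (\sum_i N i)%N; elim: k => // k IHk in N *; rewrite ltnS => Nk.
have [N0|/existsNP[i /eqP Ni]] := pselect (forall i, N i = 0%N).
  rewrite (eq_integral (cst 1%E)); last first.
    by move=> x _; rewrite /kern big1// => i _; rewrite N0 expr0.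
  rewrite integral_cst// mul1e big1; last by move=> i _; rewrite N0 /wallis big_ord0.
  exact: (@probability_setT _ _ _ (torus_measure n)).
case Nij : (N i) Ni => [//|j] _.
rewrite (integral_kern_decr _ Nij) IHk; last first.
  apply: leq_trans Nk.
  rewrite (bigD1 i)//= [X in (_ < X)%N](bigD1 i)//= /decr eqxx Nij/=.
  by rewrite (eq_bigr (fun i => N i)) ?addSn// => i' /negbTE ->.
rewrite -EFinM; congr (_%:E).
rewrite (bigD1 i)//= [RHS](bigD1 i)//= {1}/decr eqxx Nij/= wallisS.
rewrite [X in _ = _ * X](eq_bigr (fun k => @wallis R (decr N i k))); first by ring.
by move=> i' /negbTE; rewrite /decr => ->.
Qed.

(** The cube is compact, and the increment [t] may leave it because continuity of [F] at points of
    the cube is taken in the whole space. *)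
Lemma periodic_unif_continuous F (e : R) : continuous F -> Defs.periodic F -> 0 < e ->
  exists2 d : R, 0 < d &
    forall x t, (forall i, `|t 0 i| < d) -> `|F x - F (x + t)| <= e.
Proof.
move=> cF pF e0.
pose A := [set x : 'rV[R]_n | forall i, `[0%R, 1%R]%classic (x 0 i)].
have cA : compact A by exact: unit_cube_compact.
pose P (d : R) x := forall t, (forall i, `|t 0 i| < d) -> `|F x - F (x + t)| <= e.
have : \forall d \near 0^'+, A `<=` P d.
  apply: (compact_near_coveringP A).1 => // x _.
  have /cvg_ballP/(_ (e / 2)) := cF x; rewrite divr_gt0// => /(_ isT).
  move=> /nbhs_ballP[r /= r0 xr].
  near=> x' d => t /= td.
  have b1 : ball x r x' by near: x'; exact: nbhsx_ballx.
  have b2 : ball x r (x' + t).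
    have : ball x (r / 2) x'.
      by near: x'; apply: nbhsx_ballx; rewrite divr_gt0.
    move=> [_ xx']; split=> // i j; have := xx' i j; rewrite !ord1 /ball/= !mxE.
    have := td j; have : d < r / 2 by near: d; apply: nbhs_right_lt; rewrite divr_gt0.
    rewrite !ltr_norml => dr /andP[t1 t2] /andP[x1 x2]; apply/andP; split; lra.
  have := xr _ b1; have := xr _ b2; rewrite /ball/= !ltr_norml ler_norml.
  by move=> /andP[? ?] /andP[? ?]; apply/andP; split; lra.
move=> AP; have [d [dP d0]] : exists d, A `<=` P d /\ 0 < d.
  near (0 : R)^'+ => d; exists d; split; first by near: d.
  by near: d; exact: nbhs_right_gt.
exists d => // x t td.
have [k kx] := unit_cube_translate x.
by rewrite -(pF x k) -(pF (x + t) k) addrAC; exact: dP td.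
Unshelve. all: by end_near.
Qed.

(** Korovkin's argument with the test functions sin^2: close to [y] modulo integer vectors uniform
    continuity gives [e], and elsewhere some sin^2 is at least a fixed [s] > 0, which pays for the
    trivial bound 2 M. *)
Lemma korovkin F (e : R) : continuous F -> Defs.periodic F -> 0 < e ->
  exists2 C : R, 0 <= C & forall x y,
    `|F x - F y| <= e + C * \sum_i (1 - cos (pi * (x 0 i - y 0 i)) ^+ 2).
Proof.
move=> cF pF e0.
have [d' d'0 dF] := periodic_unif_continuous cF pF e0.
(* The cap 1/2 keeps pi d in [0, pi/2], where the cosine is nonnegative and decreasing, so that its
   squares compare as well. *)
pose d := Num.min d' 2^-1.
have d0 : 0 < d by rewrite lt_min d'0/= invr_gt0.
have d2 : d <= 2^-1 by rewrite ge_min lexx orbT.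
have [M FM] := periodic_bounded cF pF.
have M0 : 0 <= M by rewrite (le_trans _ (FM 0)).
have p0 : 0 < pi :> R := pi_gt0 R.
have pd : 0 < pi * d by rewrite mulr_gt0.
have pd2 : pi * d <= pi / 2 by rewrite ler_pM2l.
have cd0 : 0 <= cos (pi * d).
  by apply: cos_ge0_pihalf; rewrite pd2 andbT (le_trans _ (ltW pd))// oppr_le0 divr_ge0// ltW.
have cd1 : cos (pi * d) < 1.
  by rewrite -[ltRHS]cos0 ltr_cos// in_itv/= ?lexx ?(ltW pd) ?(ltW p0)//=; lra.
pose s := 1 - cos (pi * d) ^+ 2.
have s0 : 0 < s by rewrite subr_gt0 expr2; nra.
have sum_ge0 x y (P : pred 'I_n) :
    0 <= \sum_(i | P i) (1 - cos (pi * (x 0 i - y 0 i)) ^+ 2).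
  by apply: sumr_ge0 => i _; rewrite subr_ge0; exact: (@cosX_even_le1 R _ 1).
exists (2 * M / s) => [|x y]; first by rewrite divr_ge0 ?mulr_ge0// ltW.
(* Rounding to the nearest integer vector: [t] represents y - x modulo integers with coordinates in
   [-1/2, 1/2]. *)
pose k : 'rV[int]_n := \row_i Num.floor (y 0 i - x 0 i + 2^-1).
pose t : 'rV[R]_n := y - x - map_mx intr k.
have t2 i : `|t 0 i| <= 2^-1.
  have /andP[] := floor_itv (y 0 i - x 0 i + 2^-1); rewrite rmorphD/= => l u.
  by rewrite ler_norml !mxE; apply/andP; split; lra.
have Fy : F y = F (x + t).
  by rewrite -(pF (x + t) k); congr F; rewrite /t addrA subrK addrC subrK.
have [td|/existsNP[i /negP]] := pselect (forall i, `|t 0 i| < d).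
  rewrite Fy (le_trans (dF _ _ _))// => [i|].
    by rewrite (lt_le_trans (td i))// ge_min lexx.
  by rewrite lerDl mulr_ge0// divr_ge0 ?mulr_ge0// ltW.
rewrite -leNgt => dt.
have FF : `|F x - F y| <= 2 * M.
  rewrite (le_trans (ler_normB _ _))// mulr2n mulrDl mul1r; exact: lerD.
rewrite (le_trans FF)// ler_wpDl// ?(ltW e0)//.
rewrite mulrAC -mulrA ler_peMr ?mulr_ge0// ler_pdivlMr// mul1r.
rewrite (bigD1 i)//= ler_wpDr// lerD2l lerN2.
have -> : cos (pi * (x 0 i - y 0 i)) ^+ 2 = cos (pi * `|t 0 i|) ^+ 2.
  rewrite -(cos_periodic_even (x 0 i - y 0 i) (k 0 i) 1).
  have -> : x 0 i - y 0 i + (k 0 i)%:~R = - t 0 i by rewrite !mxE; ring.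
  by case: (ltrP 0 (t 0 i)) => t0; rewrite ?(gtr0_norm t0) ?(ler0_norm t0)// mulrN cosN.
have pt : pi * `|t 0 i| <= pi / 2 by rewrite ler_pM2l.
have pdt : pi * d <= pi * `|t 0 i| by rewrite ler_pM2l.
have ct0 : 0 <= cos (pi * `|t 0 i|).
  by apply: cos_ge0_pihalf; rewrite pt andbT; lra.
rewrite ler_sqr ?nnegrE//.
move: pdt; rewrite le_eqVlt => /predU1P[->//|lt1].
by rewrite ltW// ltr_cos// in_itv/=; apply/andP; split; lra.
Qed.

End korovkin.

(** * Comparison with Lebesgue measure *)

Section comparison.
Context {R : realType} {n : nat}.
Implicit Types (x y t : 'rV[R]_n) (F : 'rV[R]_n -> R) (i : 'I_n).

Local Notation mu := (torus_measure n).
Local Notation w j := (@wallis R j ^+ n).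
Local Notation cst_idx j := (fun _ : 'I_n => j).

Lemma integral_kern_cst j y : (\int[mu]_x (kern (cst_idx j) y x)%:E = (w j)%:E)%E.
Proof. by rewrite integral_kern prodr_const card_ord. Qed.

Lemma integral_kern_incr j i y :
  (\int[mu]_x (kern (incr (cst_idx j) i) y x)%:E =
   (w j * ((2 * j%:R + 1) / (2 * j%:R + 2)))%:E)%E.
Proof.
rewrite (@integral_kern_decr _ _ _ i j); last by rewrite /incr eqxx.
by rewrite decr_incr integral_kern_cst -EFinM mulrC.
Qed.

(** The integration is over the centre [y], which [kernC] exchanges with the variable. Each
    coordinate contributes the second moment w / (2 j + 2), the difference of two consecutive Wallis
    integrals, so the kernels concentrate as [j] grows. *)
Lemma integral_kern_le j x F (e C : R) : continuous F -> Defs.periodic F ->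
  0 <= C ->
  (forall y, `|F x - F y| <= e + C * \sum_i (1 - cos (pi * (x 0 i - y 0 i)) ^+ 2)) ->
  (\int[mu]_y (kern (cst_idx j) y x * F y)%:E <=
   (w j * (F x + e + C * n%:R / (2 * j%:R + 2)))%:E)%E.
Proof.
move=> cF pF C0 Fe.
pose N := cst_idx j.
pose G i y := C * (kern N x y - kern (incr N i) x y).
have iG i : mu.-integrable setT (fun y => (G i y)%:E).
  under eq_fun do rewrite EFinM; apply: integrableZl => //.
  under eq_fun do rewrite EFinB.
  by apply: integrableB => //; exact: kern_torus_integrable.
have iN : mu.-integrable setT (fun y => ((F x + e) * kern N x y)%:E).
  by under eq_fun do rewrite EFinM; apply: integrableZl => //; exact: kern_torus_integrable.
apply: (@le_trans _ _ (\int[mu]_y ((F x + e) * kern N x y + \sum_i G i y)%:E)%E).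
  apply: le_integral_pointwise => y; rewrite lee_fin kernC.
  under eq_bigr => i _ do rewrite /G -kern_incr mulrCA.
  rewrite -mulr_sumr [X in X + _]mulrC -mulrDr ler_wpM2l ?kern_ge0//.
  have := Fe y; rewrite ler_norml => /andP[+ _].
  have -> : \sum_i C * (1 - cos (pi * (y 0 i - x 0 i)) ^+ 2) =
      C * \sum_i (1 - cos (pi * (x 0 i - y 0 i)) ^+ 2).
    rewrite mulr_sumr; apply: eq_bigr => i _.
    by rewrite -cosN; congr (_ * (1 - cos _ ^+ 2)); ring.
  set S := C * _; lra.
under eq_integral do rewrite EFinD.
rewrite integralD//; last first.
  by under eq_fun do rewrite -sumEFin; exact: integrable_sum.
under eq_integral do rewrite EFinM.
rewrite integralZl//; last exact: kern_torus_integrable.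
under [X in (_ + X)%E]eq_integral do rewrite -sumEFin.
rewrite integral_sum// integral_kern_cst.
rewrite (eq_bigr (fun=> (C * (w j / (2 * j%:R + 2)))%:E)) => [|i _]; last first.
  under eq_integral do rewrite EFinM EFinB.
  rewrite integralZl//; last by apply: integrableB => //; exact: kern_torus_integrable.
  rewrite integralB//; [|exact: kern_torus_integrable..].
  rewrite integral_kern_cst integral_kern_incr -EFinB -EFinM; congr (_%:E).
  by field; rewrite gt_eqF// ltr_wpDl// mulr_ge0.
rewrite sumEFin sumr_const card_ord -EFinM -EFinD lee_fin -mulr_natr.
rewrite le_eqVlt; apply/orP; left; apply/eqP; field.
by rewrite gt_eqF// ltr_wpDl// mulr_ge0.
Qed.

(** The double integral of th(x) kern(x, y) F(y) is evaluated in both orders. Integrating in x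
    first, [lower] bounds it below by a multiple of the integral of F; integrating in y first,
    concentration at x bounds it above by w times the integral of th F plus an error. The Wallis
    factor w cancels. *)
Lemma integral_comparison (C0 : R) (th F : 'rV[R]_n -> R) : 0 < C0 ->
  measurable_fun setT th -> (forall x, 0 <= th x) ->
  (\int[mu]_x (th x)%:E = 1)%E ->
  (forall j y, ((@wallis R j / C0) ^+ n)%:E <=
    \int[mu]_x (th x * kern (cst_idx j) y x)%:E)%E ->
  continuous F -> Defs.periodic F -> (forall x, 0 <= F x) ->
  (\int[mu]_x (F x)%:E <= (C0 ^+ n)%:E * \int[mu]_x (th x * F x)%:E)%E.
Proof.
move=> C00 mth th0 th1 lower cF pF F0.
have mF := continuous_measurable_rV cF.
have ith : mu.-integrable setT (EFin \o th).
  apply/integrableP; split; first exact/measurable_EFinP.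
  under eq_integral do rewrite gee0_abs ?lee_fin//.
  by rewrite th1 ltry.
have iF := torus_integrable cF pF.
have ithF := torus_integrableM ith cF pF.
set IF := (\int[mu]_x (F x)%:E)%E; set IT := (\int[mu]_x (th x * F x)%:E)%E.
have fIF : IF \is a fin_num by exact: integrable_fin_num iF.
have fIT : IT \is a fin_num by exact: integrable_fin_num ithF.
have H (e C : R) j : 0 <= C -> (forall x y,
    `|F x - F y| <= e + C * \sum_i (1 - cos (pi * (x 0 i - y 0 i)) ^+ 2)) ->
    fine IF <= C0 ^+ n * (fine IT + e + C * n%:R / (2 * j%:R + 2)).
  move=> C_ge0 FC.
  have w0 : 0 < w j by rewrite exprn_gt0// wallis_gt0.
  have C0n : 0 < C0 ^+ n by rewrite exprn_gt0.
  pose f (z : 'rV[R]_n * 'rV[R]_n) :=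
    (th z.1 * (kern (cst_idx j) z.2 z.1 * F z.2))%:E.
  have mf : measurable_fun setT f.
    apply/measurable_EFinP; apply: measurable_funM.
      exact: (measurableT_comp mth measurable_fst).
    apply: measurable_funM; last exact: (measurableT_comp mF measurable_snd).
    apply: measurable_prod => i _; apply: measurable_funX.
    apply: (measurableT_comp (f := cos)).
      by apply: continuous_measurable_fun; exact: continuous_cos.
    apply: measurable_funM => //; apply: measurable_funB.
      exact: (measurableT_comp (measurable_coord i) measurable_fst).
    exact: (measurableT_comp (measurable_coord i) measurable_snd).
  have f0 z : (0 <= f z)%E by rewrite lee_fin !mulr_ge0// kern_ge0.
  have Fub := @fubini_tonelli _ _ _ _ R mu mu f mf f0.
  have LB : (((@wallis R j / C0) ^+ n)%:E * IF <= \int[mu]_y \int[mu]_x f (x, y))%E.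
    rewrite -integralZl//; apply: le_integral_pointwise => y.
    have -> : (\int[mu]_x f (x, y) =
        (F y)%:E * \int[mu]_x (th x * kern (cst_idx j) y x)%:E)%E.
      rewrite -integralZl//; last first.
        apply: torus_integrableM => //; last exact: kern_periodic.
        exact: (smooth_kern _ _ 0%N).
      by apply: eq_integral => x _; rewrite /f/= -EFinM; congr (_%:E); ring.
    by rewrite muleC lee_wpmul2l// lee_fin.
  have UB : (\int[mu]_x \int[mu]_y f (x, y) <=
      (w j)%:E * (IT + (e + C * n%:R / (2 * j%:R + 2))%:E))%E.
    pose c := e + C * n%:R / (2 * j%:R + 2).
    apply: (@le_trans _ _ (\int[mu]_x ((w j)%:E * ((th x * F x)%:E + (c * th x)%:E)))%E).
      apply: le_integral_pointwise => x.
      have -> : (\int[mu]_y f (x, y) =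
          (th x)%:E * \int[mu]_y (kern (cst_idx j) y x * F y)%:E)%E.
        rewrite -integralZl//; under eq_fun do rewrite kernC.
        by apply: torus_integrableM => //; exact: kern_torus_integrable.
      apply: le_trans (lee_wpmul2l _ (integral_kern_le j cF pF C_ge0 (FC x))) _.
        by rewrite lee_fin.
      by rewrite -EFinM -EFinD -EFinM lee_fin /c le_eqVlt; apply/orP; left; apply/eqP; ring.
    have icth : mu.-integrable setT (fun x => (c * th x)%:E).
      by under eq_fun do rewrite EFinM; exact: integrableZl.
    rewrite integralZl//; last exact: integrableD.
    rewrite integralD//; under [X in (_ + X)%E]eq_integral do rewrite EFinM.
    by rewrite integralZl// th1 mule1.
  move: UB; rewrite Fub => /(le_trans LB).
  rewrite -(fineK fIF) -(fineK fIT) -EFinD -!EFinM lee_fin expr_div_n.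
  rewrite mulrAC ler_pdivrMr// -!mulrA ler_pM2l// => /le_trans; apply.
  by rewrite mulrC addrA.
rewrite -(fineK fIF) -(fineK fIT) -EFinM lee_fin.
apply/ler_addgt0Pr => e e0.
have C0n : 0 < C0 ^+ n by rewrite exprn_gt0.
(* Half of [e] goes to the modulus of continuity and half to the second moments. [C] depends on
   [e'], so [j] is chosen last. *)
pose e' := e / (2 * C0 ^+ n).
have e'0 : 0 < e' by rewrite divr_gt0// mulr_gt0.
have [C Cge FC] := korovkin cF pF e'0.
have [j jP] : exists j : nat, C * n%:R / (2 * j%:R + 2) <= e'.
  pose j := Num.truncn (C * n%:R / e').
  exists j; rewrite ler_pdivrMr; last by rewrite ltr_wpDl// mulr_ge0.
  rewrite -ler_pdivrMl// mulrC.
  have /andP[_] : j%:R <= C * n%:R / e' < j.+1%:R.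
    exact/truncn_itv/(divr_ge0 (mulr_ge0 Cge (ler0n _ _)) (ltW e'0)).
  rewrite -natr1; have : 0 <= j%:R :> R by []; lra.
rewrite (le_trans (H e' C j Cge FC))// -addrA mulrDr lerD2l.
have -> : e = C0 ^+ n * (e' + e') by rewrite /e'; field; rewrite gt_eqF.
by rewrite ler_pM2l// lerD2l.
Qed.

End comparison.

(** * Boundedness of the drift *)

Section hamiltonian_bound.
Context {R : realType}.

(* No differentiability is assumed: without a limit, 'D_v f x is 0. *)
Lemma derive_bounded (V : normedModType R) (f : V -> R) (x v : V) (B : R) :
  0 <= B -> (forall h : R, `|h| <= 1 -> `|f (h *: v + x) - f x| <= B * `|h|) ->
  `|'D_v f x| <= B.
Proof.
move=> B0 fB; have [df|ndf] := pselect (derivable f x v); last first.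
  by rewrite /derive dvgP// normr0.
have quot : \forall h \near (0 : R)^',
    `|h^-1 *: ((f \o shift x) (h *: v) - f x)| <= B.
  near=> h.
  have h0 : h != 0 by near: h; exact: nbhs_dnbhs_neq.
  rewrite normrM normfV ler_pdivrMl ?normr_gt0// mulrC; apply: fB.
  by near: h; exact: dnbhs0_le.
rewrite ler_norml; apply/andP; split.
  by apply: limr_ge => //; apply: filterS quot => h; rewrite ler_norml => /andP[].
by apply: limr_le => //; apply: filterS quot => h; rewrite ler_norml => /andP[].
Unshelve. all: by end_near.
Qed.

End hamiltonian_bound.

Lemma continuous_pair (T U V : topologicalType) (f : T -> U) (g : T -> V) :
  continuous f -> continuous g -> continuous (fun t => (f t, g t)).
Proof. by move=> cf cg t; apply: cvg_pair; [exact: cf|exact: cg]. Qed.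

(** * Superlinear Lagrangians and local Lipschitz bounds for the Hamiltonian *)

Section lagrangian_bound.
Context {R : realType} {n : nat}.
Implicit Types (p x v : 'rV[R]_n).

Lemma coord_le_enorm v i : `|v 0 i| <= enorm v.
Proof.
rewrite -ler_sqr ?nnegrE ?sqrtr_ge0// real_normK ?num_real//.
exact: coord_sqr_le.
Qed.

Lemma dotv_bound p v (K : R) : (forall i, `|p 0 i| <= K) ->
  `|dotv p v| <= n%:R * K * enorm v.
Proof.
move=> pK; rewrite (le_trans (ler_norm_sum _ _ _))//.
rewrite (le_trans (y := \sum_(i < n) K * enorm v))//.
  by apply: ler_sum => i _; rewrite normrM ler_pM// coord_le_enorm.
by rewrite sumr_const card_ord -[leLHS]mulr_natl mulrA.
Qed.

Variables (L : 'rV[R]_n -> 'rV[R]_n -> R) (gamma : R -> R).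
Hypotheses (lagL : is_lagrangian L) (gr : is_growth_function L gamma).

Lemma lagrangian_superlinear (M : R) : 0 <= M ->
  exists2 r : R, 1 <= r & forall x v, r <= enorm v -> M * enorm v <= L x v.
Proof.
move=> M0; have [_ g1 gL gl] := gr.
have [r1 [_ r1P]] : \forall r \near +oo, `|r / gamma r| < 1.
  by move/cvgrPdist_lt : gl => /(_ 1 ltr01); apply: filterS => r; rewrite sub0r normrN.
have [r2 r2P] := gL M.
exists (Num.max 1 (Num.max (r1 + 1) r2)); first by rewrite le_max lexx.
move=> x v; rewrite !ge_max => /and3P[v1 vr1 vr2].
have g0 : 0 < gamma (enorm v) by rewrite (lt_le_trans ltr01).
have := r2P x v vr2; rewrite ler_pdivlMr// => /(le_trans _); apply.
rewrite ler_wpM2l//.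
have : `|enorm v / gamma (enorm v)| < 1 by apply: r1P; lra.
rewrite ger0_norm; last by rewrite divr_ge0 ?sqrtr_ge0// ltW.
by rewrite ltr_pdivrMr// mul1r => /ltW.
Qed.

(** For momenta bounded by [K], velocities with |v| >= r do no better than v = 0, so the supremum is
    governed by |v| < r, where moving p by h along a coordinate axis changes the objective by at
    most r |h|. *)
Lemma hamiltonian_lipschitz (K : R) : 0 <= K ->
  exists2 r : R, 0 <= r & forall p x i (h : R), (forall j, `|p 0 j| <= K) ->
    (forall j, `|(h *: delta_mx 0 i + p) 0 j| <= K) ->
    hamiltonian L (h *: delta_mx 0 i + p) x <= hamiltonian L p x + r * `|h|.
Proof.
move=> K0; have [Ls Lp _ _ L0] := lagL.
have cL : continuous (fun x => L x 0).
  have pc : continuous (fun x : 'rV[R]_n => (x, 0 : 'rV[R]_n)).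
    by apply: continuous_pair; [move=> x; exact: cvg_id|exact: cst_continuous].
  move=> x; exact: (cvg_comp _ _ (pc x) (Ls 0%N (x, 0))).
have pL : Defs.periodic (fun x => L x 0) by move=> x k; rewrite Lp.
have [l Ll] := periodic_bounded cL pL.
have l0 : 0 <= l by rewrite (le_trans _ (Ll 0)).
have nK : 0 <= n%:R * K by rewrite mulr_ge0.
(* The slope n K absorbs p . v. The additional slope [l], with r >= 1, pushes the objective below -l
   <= -L(x, 0), its value at v = 0 up to the bound [l]. *)
have [r r1 rP] := lagrangian_superlinear (addr_ge0 nK l0).
have r0 : 0 <= r by rewrite (le_trans ler01).
have ubH p x : (forall j, `|p 0 j| <= K) -> has_ubound (range (fun v => - dotv p v - L x v)).
  move=> pK; exists (n%:R * K * r) => _ [v _ <-].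
  have := dotv_bound v pK; rewrite ler_norml => /andP[pv _].
  have [rv|rv] := lerP r (enorm v).
    have := rP x v rv; have : 0 <= l * enorm v by rewrite mulr_ge0// sqrtr_ge0.
    have : 0 <= n%:R * K * r by rewrite mulr_ge0.
    rewrite mulrDl; lra.
  have := L0 x v; have : n%:R * K * enorm v <= n%:R * K * r by rewrite ler_wpM2l// ltW.
  lra.
exists r => // p x i h pK p'K.
apply: ge_sup => [|_ [v _ <-]]; first by exists (- dotv (h *: delta_mx 0 i + p) 0 - L x 0); exists 0.
have [rv|rv] := lerP r (enorm v).
  apply: (@le_trans _ _ (- L x 0)).
    have := dotv_bound v p'K; rewrite ler_norml => /andP[pv _].
    have := rP x v rv; have : l <= l * enorm v by rewrite ler_peMr// (le_trans r1).
    have := Ll x; rewrite ler_norml => /andP[_ Lx].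
    rewrite mulrDl; lra.
  rewrite -[leLHS]addr0 lerD ?mulr_ge0//.
  apply: ub_le_sup; first exact: ubH.
  exists 0 => //; rewrite /dotv big1 ?oppr0 ?add0r// => j _.
  by rewrite mxE mulr0.
have -> : dotv (h *: delta_mx 0 i + p) v = h * v 0 i + dotv p v.
  rewrite /dotv; under eq_bigr => j _ do rewrite !mxE mulrDl.
  rewrite big_split/= (bigD1 i)//= !eqxx/= mulr1 big1 ?addr0// => j /negbTE ->.
  by rewrite mulr0 mul0r.
rewrite opprD -addrA addrC lerD//; last first.
  rewrite (le_trans (ler_norm _))// normrN normrM mulrC ler_wpM2r//.
  by rewrite (le_trans (coord_le_enorm _ _))// ltW.
by apply: ub_le_sup; [exact: ubH|exists v].
Qed.

Lemma grad_hamiltonian_bound (K : R) : 0 <= K ->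
  exists2 B : R, 0 <= B & forall p x i, (forall j, `|p 0 j| <= K) ->
    `|grad (fun p => hamiltonian L p x) p 0 i| <= B.
Proof.
(* The larger bound K + 1 leaves room for increments |h| <= 1; the reverse inequality is the same
   bound applied from the shifted point with -h. *)
move=> K0; have [r r0 rP] := hamiltonian_lipschitz (addr_ge0 K0 (@ler01 R)).
exists r => // p x i pK; rewrite mxE; apply: derive_bounded => // h h1.
have pK1 j : `|p 0 j| <= K + 1 by rewrite (le_trans (pK j))// lerDl.
have p'K1 j : `|(h *: delta_mx 0 i + p) 0 j| <= K + 1.
  rewrite !mxE (le_trans (ler_normD _ _))// addrC lerD// normrM.
  by rewrite (le_trans _ h1)// ler_piMr//; case: (_ && _); rewrite ?normr1 ?normr0.
have H1 := rP p x i h pK1 p'K1.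
have /= := rP (h *: delta_mx 0 i + p) x i (- h) p'K1.
rewrite addrA -scalerDl addNr scale0r add0r normrN => /(_ pK1) H2.
by rewrite ler_distl; apply/andP; split; lra.
Qed.

End lagrangian_bound.

(** * The estimate for gradient fields *)

Section gradient_fields.
Context {R : realType} {n : nat}.

Lemma integral_shifted_gradient (q : 'rV[R]_n) (w w' : 'rV[R]_n -> R) :
  Ck 1 w -> Ck 1 w' -> Defs.periodic w -> Defs.periodic w' ->
  ((enorm q ^+ 2)%:E <=
   \int[torus_measure n]_x (enorm (q + (grad w x - grad w' x)) ^+ 2)%:E)%E.
Proof.
move=> Cw Cw' pw pw'.
have id (f : 'rV[R]_n -> R) i : Ck 1 f -> Defs.periodic f ->
    (torus_measure n).-integrable setT (fun x => ('D_(delta_mx 0 i) f x)%:E).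
  by move=> Cf pf; apply: torus_integrable;
    [exact: Ck1_derive_continuous|exact: periodic_derive].
pose G i x := (2 * q 0 i) * ('D_(delta_mx 0 i) w x - 'D_(delta_mx 0 i) w' x).
have iB i : (torus_measure n).-integrable setT
    (fun x => ('D_(delta_mx 0 i) w x - 'D_(delta_mx 0 i) w' x)%:E).
  by under eq_fun do rewrite EFinB; apply: integrableB => //; exact: id.
have iG i : (torus_measure n).-integrable setT (fun x => (G i x)%:E).
  by under eq_fun do rewrite EFinM; exact: integrableZl.
have G0 i : (\int[torus_measure n]_x (G i x)%:E = 0)%E.
  under eq_integral do rewrite EFinM.
  rewrite integralZl//; under eq_integral do rewrite EFinB.
  rewrite integralB//; [|exact: id..].
  by rewrite !integral_derive0// sube0 mule0.
(* Dropping the square of the gradient difference from the expanded norm leaves a constant plus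
   cross terms of mean zero. *)
apply: (@le_trans _ _ (\int[torus_measure n]_x (enorm q ^+ 2 + \sum_i G i x)%:E)%E).
  under eq_integral do rewrite EFinD -sumEFin.
  have i1 : (torus_measure n).-integrable setT (fun=> (enorm q ^+ 2)%:E).
    by apply: (@torus_integrable _ _ (fun=> enorm q ^+ 2)) => //; exact: cst_continuous.
  rewrite integralD//; last exact: integrable_sum.
  rewrite integral_sum// big1 ?adde0; last by move=> i _; exact: G0.
  rewrite integral_cst//.
  have /= := @probability_setT _ _ _ (torus_measure n).
  by rewrite /setT => ->; rewrite mule1.
apply: le_integral_pointwise => x; rewrite lee_fin !enorm_sqr -big_split/=.
apply: ler_sum => i _; rewrite /G !mxE.
set d := 'D_ _ w x - _.
by rewrite -subr_ge0 (_ : _ - _ = d ^+ 2) ?sqr_ge0//; ring.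
Qed.

End gradient_fields.

(** * Coercivity of the weighted gradient difference *)

Theorem theorem11 (R : realType) (n : nat)
    (L : 'rV[R]_n -> 'rV[R]_n -> R) (gamma : R -> R)
    (sigma : R) (P : 'rV[R]_n)
    (Hbar : 'rV[R]_n -> R) (u : 'rV[R]_n -> 'rV[R]_n -> R)
    (theta : 'rV[R]_n -> R) :
  is_lagrangian L ->
  is_growth_function L gamma ->
  0 < sigma ->
  is_effective_hamiltonian (hamiltonian L) sigma Hbar ->
  (exists2 r : R, 0 < r & strictly_convex_on (ball P r) Hbar) ->
  (forall Q, periodic_viscosity_solution (hamiltonian L) sigma Q (Hbar Q) (u Q)) ->
  mather_density L gamma sigma u P theta ->
  exists2 C : R, 0 < C &
  exists2 delta : R, 0 < delta &
  forall P' : 'rV[R]_n, enorm (P - P') < delta ->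
    ((C * enorm (P - P') ^+ 2)%:E <=
     \int[torus_measure n]_x
       (enorm (P + grad (u P) x - P' - grad (u P') x) ^+ 2 * theta x)%:E)%E.
Proof.
move=> lagL gr sigma0 effH _ solu [_ th0 th1 FP].
have Cu Q : Ck 1 (u Q) := CkW (eff_regular effH (solu Q)).
have pu Q : Defs.periodic (u Q) := visc_periodic (solu Q).
have cdu Q i : continuous ('D_(delta_mx 0 i) (u Q)) by exact: Ck1_derive_continuous.
have pdu Q i : Defs.periodic ('D_(delta_mx 0 i) (u Q)) by exact: periodic_derive.
have cg i : continuous (fun x => P 0 i + 'D_(delta_mx 0 i) (u P) x).
  move=> x; apply: (@continuousD _ _ _ (fun=> P 0 i) ('D_(delta_mx 0 i) (u P))); first exact: cst_continuous.
  exact: cdu.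
have pg i : Defs.periodic (fun x => P 0 i + 'D_(delta_mx 0 i) (u P) x).
  by move=> x k; congr (_ + _); exact: pdu.
have [K KP] : exists K, forall x i, `|(P + grad (u P) x) 0 i| <= K.
  pose S x := \sum_i `|P 0 i + 'D_(delta_mx 0 i) (u P) x|.
  have cS : continuous S.
    apply: (sum_continuous (F := fun i x => `|P 0 i + 'D_(delta_mx 0 i) (u P) x|)) => i.
    exact: normr_continuous.
  have pS : Defs.periodic S.
    by move=> x k; apply: eq_bigr => i _; congr `|_|; exact: pg.
  have [K SK] := periodic_bounded cS pS; exists K => x i.
  rewrite !mxE (le_trans _ (le_trans (ler_norm _) (SK x)))// /S.
  by rewrite (bigD1 i)//= lerDl sumr_ge0.
have [B B0 bB] := grad_hamiltonian_bound lagL gr (normr_ge0 K).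
have bB' x i : `|(- grad (fun p => hamiltonian L p x) (P + grad (u P) x)) 0 i| <= B.
  by rewrite mxE normrN; apply: bB => j; exact: le_trans (KP x j) (ler_norm _).
pose k := B / (sigma ^+ 2 / 2 * pi).
(* [C0] is determined by [sigma] and the drift bound [B] at P, and is fixed before P' is introduced.
   Its n-th power appears because a kernel has n factors, each losing at most [C0] against the
   Wallis product. *)
have [C0 C00 wC] := wallis_bar_bound k.
exists (C0 ^+ n)^-1; first by rewrite invr_gt0 exprn_gt0.
exists 1 => // P' _.
pose F x := enorm (P + grad (u P) x - P' - grad (u P') x) ^+ 2.
pose D (i : 'I_n) (x : 'rV[R]_n) : R := P 0 i - P' 0 i +
  ('D_(delta_mx 0 i) (u P) x - 'D_(delta_mx 0 i) (u P') x).
have FE x : F x = \sum_i D i x ^+ 2.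
  by rewrite /F enorm_sqr; apply: eq_bigr => i _; rewrite /D !mxE; congr (_ ^+ 2); ring.
have cD i : continuous (D i).
  move=> x; apply: (@continuousD _ _ _ (fun=> P 0 i - P' 0 i)
    (fun x => 'D_(delta_mx 0 i) (u P) x - 'D_(delta_mx 0 i) (u P') x)).
    exact: cst_continuous.
  by apply: (@continuousB _ _ _ ('D_(delta_mx 0 i) (u P)) ('D_(delta_mx 0 i) (u P')));
    exact: cdu.
have cF : continuous F.
  rewrite (_ : F = fun x => \sum_i D i x ^+ 2); last exact/funext/FE.
  apply: (sum_continuous (F := fun i x => D i x ^+ 2)) => i.
  exact: (@continuous_sqr _ _ (D i) (cD i)).
have pF : Defs.periodic F.
  move=> x l; rewrite !FE; apply: eq_bigr => i _.
  by congr ((_ + (_ - _)) ^+ 2); exact: pdu.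
have F0 x : 0 <= F x by exact: sqr_ge0.
have [mt it] := fp_integrable FP.
have mat : measurable_fun setT (fun x => `|theta x|) by exact: measurableT_comp.
have mF := continuous_measurable_rV cF.
have -> : (\int[torus_measure n]_x (F x * theta x)%:E =
    \int[torus_measure n]_x (`|theta x| * F x)%:E)%E.
  apply: ae_eq_integral => //.
  - by apply/measurable_EFinP; exact: measurable_funM.
  - by apply/measurable_EFinP; exact: measurable_funM.
  - by apply: filterS th0 => x t0 _; rewrite (ger0_norm t0) mulrC.
have lower j y : (((@wallis R j / C0) ^+ n)%:E <=
    \int[torus_measure n]_x (`|theta x| * kern (fun=> j) y x)%:E)%E.
  apply: le_trans (kern_lower_bound B0 bB' FP sigma0 th0 th1 (fun=> j) y).
  rewrite lee_fin prodr_const card_ord lerXn2r ?nnegrE//.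
  - by rewrite divr_ge0 ?(ltW C00) ?(ltW (wallis_gt0 _)).
  - by apply: prodr_ge0 => l _; rewrite divr_ge0 ?(ltW (bar_p_gt0 _)) ?(ltW (bar_q_gt0 _ _)).
  - by rewrite ler_pdivrMr// mulrC; exact: wC.
have cmp := integral_comparison C00 mat (fun x => normr_ge0 _)
  (abs_theta1 FP th0 th1) lower cF pF F0.
have := integral_shifted_gradient (P - P') (Cu P) (Cu P') (pu P) (pu P').
rewrite (_ : (fun x => _) = (fun x => (F x)%:E)); last first.
  by apply/funext => x; rewrite /F; congr (enorm _ ^+ 2)%:E; apply/rowP => i; rewrite !mxE; ring.
move=> /le_trans/(_ cmp) H.
have C0n : 0 < C0 ^+ n by rewrite exprn_gt0.
by rewrite EFinM -(@lee_pmul2l _ (C0 ^+ n)%:E)// muleA -EFinM divff ?gt_eqF// mul1r.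
Qed.
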